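(* Let $X$ be the generic symmetric $6\times 6$ matrix. The $\mathfrak S_6$-representation $\mathrm{MonHaf}_6(Y)$ is the sum of three irreducible representations of $\mathfrak S_6$, namely those corresponding to the partitions $[6]$, $[4,2]$ and $[2,2,2]$, of dimensions $1$, $9$ and $5$ respectively. The image of the map $\Phi:\mathrm{MonHaf}_6(Y)\to P_3(X)$, $\Phi(h)=h\circ\mathrm{perm}(X)$, is $10$-dimensional and is the sum of the irreducible representations corresponding to the partitions $[6]$ and $[4,2]$; the kernel of $\Phi$ is $5$-dimensional and corresponds to the irreducible representation of the partition $[2,2,2]$. Moreover, there is a duality between $\Phi$ and the map $\Psi:\mathrm{MonHaf}_6(Y)\to M_3(X)$, $\Psi(h)=h\circ\det(X)$: the kernel of $\Phi$ is the image of $\Psi$ after the variables of $R$ are replaced by the variables of $S$, and vice versa; that is, $\ker\Phi=\xi(\mathrm{Im}\,\Psi)$ and $\ker\Psi=\xi(\mathrm{Im}\,\Phi)$.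
   Context: $\mathsf k$ is an infinite field of characteristic zero or of characteristic $p>2$. $X=(x_{ij})$ is the generic symmetric $6\times6$ matrix ($x_{ij}=x_{ji}$, with $x_{ij}$, $i\le j$, distinct variables), $R=\mathsf k[x_{ij}:i\le j]$, $S=\mathsf k[y_{ij}: i\le j]$ with $y_{ij}=y_{ji}$, $Y=(y_{ij})$, and $\xi:R\to S$ is the ring isomorphism $\xi(x_{ij})=y_{ij}$, which replaces the variables of $R$ by those of $S$. $S$ acts on $R$ by differentiation ($y_{ij}$ acts as $\partial/\partial x_{ij}$; the action is written $h\circ F$). $\mathrm{perm}(X)$ and $\det(X)$ are the permanent and determinant of $X$. $S_3$ is the degree-$3$ homogeneous part of $S$. $P_3(X)=S_3\circ\mathrm{perm}(X)$ is the space spanned by the permanents of the $3\times3$ submatrices of $X$, and $M_3(X)=S_3\circ\det(X)$ is the space spanned by the $3\times 3$ minors of $X$. The symmetric group $\mathfrak S_6$ acts on $R$ and on $S$ by simultaneous permutation of row and column indices, $\sigma(x_{ij})=x_{\sigma(i)\sigma(j)}$, $\sigma(y_{ij})=y_{\sigma(i)\sigma(j)}$. $\mathrm{MonHaf}_6(Y)\subset S_3$ is the $15$-dimensional span of the monomials of the hafnian of $Y$, i.e. of the monomials $y_{a_1a_2}y_{a_3a_4}y_{a_5a_6}$ with $\{a_1,\dots,a_6\}=\{1,\dots,6\}$.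
   Formalization: The decompositions of MonHaf_6(Y) and Im Φ, with irreducibility and dimensions, are stated for characteristic other than 3 and 5, and the [2,2,2] kernel and duality claims for characteristic other than 3, because the lemma as stated fails in characteristics 3 and 5. *)

(* Defs.v *)
From HB Require Import structures.
From mathcomp Require Import all_boot all_order all_algebra all_fingroup.
From mathcomp Require Import all_character.
From mathcomp Require Import ssrcomplements mpoly.

Set Implicit Arguments.
Unset Strict Implicit.
Unset Printing Implicit Defensive.

Import GRing.Theory.
Local Open Scope ring_scope.

Definition infinite_field (k : fieldType) : Prop :=
  forall s : seq k, exists x, x \notin s.

(* R = k[x_ij : i <= j] and S = k[y_ij : i <= j] are two copies of            *)
(* {mpoly k[21]}: variable number v stands for x_ij (resp. y_ij), where       *)
(* (i, j), i <= j, is the v-th element of upairs.                             *)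

Definition upairs : seq (nat * nat) :=
  [seq (i, j) | i <- iota 0 6, j <- iota i (6 - i)].

Definition var (i j : 'I_6) : 'I_21 := inord (index (minn i j, maxn i j) upairs).
Definition var_fst (v : 'I_21) : 'I_6 := inord (nth (0, 0)%N upairs v).1.
Definition var_snd (v : 'I_21) : 'I_6 := inord (nth (0, 0)%N upairs v).2.

Lemma varC i j : var i j = var j i.
Proof. by rewrite /var minnC maxnC. Qed.

Lemma var_index_lt (i j : 'I_6) : (index (minn i j, maxn i j) upairs < 21)%N.
Proof.
by case: i j => [[|[|[|[|[|[|i]]]]]] Hi] [[|[|[|[|[|[|j]]]]]] Hj].
Qed.

Lemma varK (v : 'I_21) : var (var_fst v) (var_snd v) = v.
Proof.
apply/val_inj; rewrite /= inordK ?var_index_lt //.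
have v_in : nth (0, 0)%N upairs v \in upairs by apply: mem_nth; case: v.
move: (v_in) => /(allP (_ : all (fun p => [&& p.1 <= p.2, p.1 < 6 & p.2 < 6]) upairs)%N).
case/(_ isT)/and3P => le12 lt1 lt2.
rewrite /var_fst /var_snd !inordK // (minn_idPl le12) (maxn_idPr le12).
by rewrite -surjective_pairing index_uniq //; case: v {le12 lt1 lt2}.
Qed.

Lemma var_fst_snd (i j : 'I_6) :
  (var_fst (var i j), var_snd (var i j)) = if (i <= j)%N then (i, j) else (j, i).
Proof.
have u : (minn i j, maxn i j) \in upairs by rewrite -index_mem; exact: var_index_lt.
rewrite /var_fst /var_snd /var inordK ?var_index_lt //.
rewrite nth_index //; cbn [fst snd].
by have [le|lt] := leqP i j; rewrite !inord_val.
Qed.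

(* Forms of degree d, in the x's or in the y's: R_d and S_d. *)
Notation forms k d := (dhomog 21 k d).

Section Forms.
Variable k : fieldType.

Definition x_ (i j : 'I_6) : {mpoly k[21]} := 'X_(var i j).
Definition y_ (i j : 'I_6) : {mpoly k[21]} := 'X_(var i j).

Lemma homog_var (v : 'I_21) : ('X_v : {mpoly k[21]}) \is 1.-homog.
Proof. by rewrite dhomogX; apply/eqP; apply: mdeg1. Qed.

Lemma homog_prod1 n (f : 'I_n -> {mpoly k[21]}) :
  (forall i, f i \is 1.-homog) -> \prod_i f i \is n.-homog.
Proof.
elim: n f => [|n IHn] f hf; first by rewrite big_ord0 dhomog1.
by rewrite big_ord_recl; apply: (dhomogM (hf ord0)); exact: IHn.
Qed.

Lemma homog_subst (l : 21.-tuple {mpoly k[21]}) d (F : {mpoly k[21]}) :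
  (forall v, tnth l v \is 1.-homog) -> F \is d.-homog -> F \mPo l \is d.-homog.
Proof.
move=> hl hF; rewrite comp_mpolyE big_seq; apply: rpred_sum => m mF.
apply: rpredZ; rewrite -(dhomog_mf hF mF) /= mdegE.
elim/big_ind2: _ => [|p d1 q d2|v _]; [exact: dhomog1|exact: dhomogM|].
by have := dhomogMn (m v) (hl v); rewrite mul1n.
Qed.

Definition xi_tuple : 21.-tuple {mpoly k[21]} :=
  [tuple y_ (var_fst v) (var_snd v) | v < 21].

Definition perm_tuple (s : 'S_6) : 21.-tuple {mpoly k[21]} :=
  [tuple x_ (s (var_fst v)) (s (var_snd v)) | v < 21].

Lemma xi_subproof d (F : forms k d) : (F : {mpoly k[21]}) \mPo xi_tuple \is d.-homog.
Proof.
apply: homog_subst; last exact: dhomog_is_dhomog.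
by move=> v; rewrite tnth_mktuple homog_var.
Qed.

Lemma sact_subproof s d (F : forms k d) :
  (F : {mpoly k[21]}) \mPo perm_tuple s \is d.-homog.
Proof.
apply: homog_subst; last exact: dhomog_is_dhomog.
by move=> v; rewrite tnth_mktuple homog_var.
Qed.

Definition xi_fun d (F : forms k d) : forms k d := DHomog (xi_subproof F).

(* The action x_ij |-> x_{s(i)s(j)} of s on R_d, and likewise on S_d. Products *)
(* in 'S_6 are read left to right, so that this is a right action, as are the  *)
(* matrix representations of the library (sactM below).                        *)
Definition sact d (s : 'S_6) (F : forms k d) : forms k d :=
  DHomog (sact_subproof s F).

Lemma comp_mpolyA n (l1 l2 l3 : n.-tuple {mpoly k[n]}) (G : {mpoly k[n]}) :
  (forall v, tnth l3 v = tnth l1 v \mPo l2) -> (G \mPo l1) \mPo l2 = G \mPo l3.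
Proof.
move=> H; elim/mpolyind: G => [|c m p _ _ IH]; first by rewrite !comp_mpoly0.
rewrite !comp_mpolyD !comp_mpolyZ IH; congr (_ *: _ + _).
rewrite !comp_mpolyX rmorph_prod; apply: eq_bigr => v _.
by rewrite rmorphXn H.
Qed.

Lemma tnth_perm_tuple (s : 'S_6) v :
  tnth (perm_tuple s) v = x_ (s (var_fst v)) (s (var_snd v)).
Proof. exact: tnth_mktuple. Qed.

Lemma x_perm (s : 'S_6) (i j : 'I_6) : x_ i j \mPo perm_tuple s = x_ (s i) (s j).
Proof.
rewrite {1}/x_ comp_mpolyXU -tnth_nth tnth_perm_tuple.
have := var_fst_snd i j; case: ifP => _ [-> ->]; first by [].
by rewrite /x_ varC.
Qed.

Lemma sactM d (s t : 'S_6) (F : forms k d) :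
  sact (s * t)%g F = sact t (sact s F).
Proof.
apply/val_inj; apply: esym; apply: comp_mpolyA => v.
have E1 := tnth_perm_tuple s v; have E2 := tnth_perm_tuple (s * t)%g v.
have E3 := x_perm t (s (var_fst v)) (s (var_snd v)).
apply: (etrans E2); rewrite (permM s t (var_fst v)) (permM s t (var_snd v)).
by rewrite -E3 -E1.
Qed.

Lemma xi_is_linear d : linear (@xi_fun d).
Proof. by move=> c p q; apply/val_inj; rewrite /= linearP. Qed.
HB.instance Definition _ d :=
  GRing.isLinear.Build k (forms k d) (forms k d) _ (@xi_fun d) (@xi_is_linear d).

Definition xi d : 'Hom(forms k d, forms k d) := linfun (@xi_fun d).

(* y^m acts as the iterated partial derivative F^`M[m]; these are genuine     *)
(* derivatives, not contractions.                                             *)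

Definition diff_act (h F : {mpoly k[21]}) : {mpoly k[21]} :=
  \sum_(m <- msupp h) h@_m *: F^`M[m].

Lemma diff_act_wE w (h F : {mpoly k[21]}) : (msize h <= w)%N ->
  diff_act h F = \sum_(m : 'X_{1..21 < w}) h@_m *: F^`M[m].
Proof.
move=> le_hw; rewrite /diff_act (big_mksub [the subFinType _ of (bmultinom 21 w)]) //=; first last.
- by move=> m /msize_mdeg_lt /leq_trans; apply.
- exact: msupp_uniq.
rewrite big_rmcond // => m /memN_msupp_eq0 ->; exact: scale0r.
Qed.

Lemma diff_act_linear F : linear (diff_act^~ F).
Proof.
move=> c p q.
pose w := maxn (msize (c *: p + q)) (maxn (msize p) (msize q)).
rewrite (@diff_act_wE w (c *: p + q)) ?leq_maxl //.
rewrite (@diff_act_wE w p) ?(@diff_act_wE w q); last 2 first.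
- by rewrite /w !leq_max leqnn !orbT.
- by rewrite /w !leq_max leqnn !orbT.
rewrite scaler_sumr -big_split /=; apply: eq_bigr => m _.
by rewrite mcoeffD mcoeffZ scalerDl scalerA.
Qed.

Lemma homog_diff_act d e (h F : {mpoly k[21]}) :
  h \is d.-homog -> F \is (d + e).-homog -> diff_act h F \is e.-homog.
Proof.
move=> hh hF; rewrite /diff_act big_seq; apply: rpred_sum => m mh.
apply: rpredZ; apply/dhomogP => m'; rewrite mcoeff_msupp mcoeff_mderivm.
move=> nz; have: (m + m')%MM \in msupp F.
  by rewrite mcoeff_msupp; apply: contraNneq nz => ->; rewrite mul0rn.
move=> /(dhomog_mf hF) /=; rewrite mdegD.
by have /= -> := dhomog_mf hh mh; move/addnI.
Qed.

Lemma apolar_subproof d e (F : forms k (d + e)) (h : forms k d) :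
  diff_act h F \is e.-homog.
Proof. apply: homog_diff_act; exact: dhomog_is_dhomog. Qed.

Definition apolar_fun d e (F : forms k (d + e)) (h : forms k d) : forms k e :=
  DHomog (apolar_subproof F h).

Lemma apolar_is_linear d e (F : forms k (d + e)) : linear (apolar_fun F).
Proof. by move=> c p q; apply/val_inj; rewrite /= diff_act_linear. Qed.
HB.instance Definition _ d e F :=
  GRing.isLinear.Build k (forms k d) (forms k e) _ (@apolar_fun d e F)
    (@apolar_is_linear d e F).

(* h |-> h o F, from S_d to R_e, for a form F of degree d + e *)
Definition apolar d e (F : forms k (d + e)) : 'Hom(forms k d, forms k e) :=
  linfun (apolar_fun F).

Lemma apolarE d e (F : forms k (d + e)) (h : forms k d) :
  apolar F h = diff_act h F :> {mpoly k[21]}.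
Proof. by rewrite lfunE. Qed.


Definition permanent (A : comNzRingType) n (M : 'M[A]_n) : A :=
  \sum_(s : 'S_n) \prod_i M i (s i).

Definition X : 'M[{mpoly k[21]}]_6 := \matrix_(i, j) x_ i j.

Lemma homog_prod_X (s : 'S_6) : \prod_i X i (s i) \is 6.-homog.
Proof. by apply: homog_prod1 => i; rewrite mxE homog_var. Qed.

Lemma permX_subproof : permanent X \is (3 + 3).-homog.
Proof. by apply: rpred_sum => s _; exact: homog_prod_X. Qed.

Lemma detX_subproof : \det X \is (3 + 3).-homog.
Proof.
apply: rpred_sum => s _; rewrite -signr_odd mulr_sign.
by case: ifP => _; rewrite ?rpredN homog_prod_X.
Qed.

Definition perm_form : forms k (3 + 3) := DHomog permX_subproof.
Definition det_form : forms k (3 + 3) := DHomog detX_subproof.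

(* h |-> h o perm(X) and h |-> h o det(X), on S_3 *)
Definition Phi : 'Hom(forms k 3, forms k 3) := apolar perm_form.
Definition Psi : 'Hom(forms k 3, forms k 3) := apolar det_form.

Definition P3 : {vspace forms k 3} := (Phi @: fullv)%VS.
Definition M3 : {vspace forms k 3} := (Psi @: fullv)%VS.

Lemma haf_subproof (a : 'S_6) :
  \prod_(t < 3) y_ (a (inord t.*2)) (a (inord t.*2.+1)) \is 3.-homog.
Proof.
by apply: homog_prod1 => t; exact: homog_var.
Qed.

Definition haf_monomial (a : 'S_6) : forms k 3 := DHomog (haf_subproof a).

Definition MonHaf : {vspace forms k 3} := <<[seq haf_monomial a | a : 'S_6]>>%VS.

(* The tableau of shape lam filled row by row with 0, ..., 5 has i in row     *)
(* reshape_index lam i and column reshape_offset lam i.                       *)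
Definition row_stab (lam : seq nat) : {set 'S_6} :=
  [set s : 'S_6 | [forall i, reshape_index lam (s i) == reshape_index lam i]].
Definition col_stab (lam : seq nat) : {set 'S_6} :=
  [set s : 'S_6 | [forall i, reshape_offset lam (s i) == reshape_offset lam i]].

(* The Young symmetrizer (\sum_(s in row_stab) s) (\sum_(t in col_stab) +-t), *)
(* in the coordinates of the regular representation.                          *)
Definition young_symmetrizer (lam : seq nat) : 'rV[k]_#|[set: 'S_6]| :=
  \sum_(s in row_stab lam) \sum_(t in col_stab lam)
    (-1) ^+ odd_perm t *: delta_mx 0 (gring_index [set: 'S_6] (s * t)%g).

(* The Specht module: the right ideal generated by the Young symmetrizer.     *)
Definition specht_mx (lam : seq nat) :=
  cyclic_mx (regular_repr k [set: 'S_6]) (young_symmetrizer lam).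

Definition specht_repr (lam : seq nat) :
    mx_representation k [set: 'S_6] (\rank (specht_mx lam)) :=
  submod_repr (cyclic_mx_module (regular_repr k [set: 'S_6])
                                (young_symmetrizer lam)).

(* The subspace V of R_d or S_d is S_6-stable and isomorphic to rG.           *)
Definition affords d (V : {vspace forms k d})
    n (rG : mx_representation k [set: 'S_6] n) : Prop :=
  exists2 b : n.-tuple (forms k d), basis_of V b &
    forall (s : 'S_6) (i : 'I_n),
      sact s (tnth b i) = \sum_(j < n) rG s i j *: tnth b j.

(* V is the (internal direct) sum of the representations of the partitions    *)
(* listed in lams.                                                            *)
Definition specht_sum d (V : {vspace forms k d}) (lams : seq (seq nat)) : Prop :=
  exists W : 'I_(size lams) -> {vspace forms k d},
    [/\ V = (\sum_i W i)%VS, directv (\sum_i W i) &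
        forall i, affords (W i) (specht_repr (nth [::] lams i))].

End Forms.

(* Main.v *)
From HB Require Import structures.
Require Import Defs.
From mathcomp Require Import all_boot all_order all_algebra all_fingroup.
From mathcomp Require Import all_character.
From mathcomp Require Import mpoly.

Set Implicit Arguments.
Unset Strict Implicit.
Unset Printing Implicit Defensive.

Import GRing.Theory.
Local Open Scope ring_scope.

(** The group 'S_6 permutes the 15 hafnian monomials as it permutes the perfect
    matchings of {0, ..., 5}, so MonHaf is the permutation module on matchings.
    Since perm X and det X are invariant, Phi and Psi commute with 'S_6
    (sact_Phi, sact_Psi) and are determined by the image of one monomial, that
    of M0 = {01, 23, 45}.  The coefficient of a matching M in Phi M0 is 2 ^ c,
    where c is the number of components of the multigraph M0 + M: it is 8 for
    M = M0, 4 for the six M that share exactly one edge with M0, and 2 for the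
    eight others.  In Psi M0 each permutation contributes its sign, and the
    coefficients are -8, 4 and -2 (Phi_haf, Psi_haf).

    If A denotes the relation of sharing exactly one edge and J the all-ones
    matrix, then Phi = 6 + 2 A + 2 J and Psi = -6 + 6 A - 2 J; as the
    graph of A is strongly regular with eigenvalues 6, 1, -3 of multiplicities 1, 9, 5,
    the eigenvalues of Phi are 48, 8, 0 and those of Psi are 0, 0, -24.  These
    eigenvalues collide in characteristics 3 and 5, so the dimensions are found
    from explicit vectors instead.  For each of the ten splittings of the six
    indices into two triples T and T', the permanent of the submatrix of X with
    rows T and columns T' lies in the image of Phi, and these ten are free; the
    corresponding determinants lie in the kernel of Phi, and five of them are
    free.  As 10 + 5 = 15, nothing else is left (dim_kernel_image).  The duality
    follows from Phi Psi = Psi Phi = 0 and from Psi = -24 on the determinants.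

    A Specht module is the right ideal generated by c = a b, where a sums the
    row stabilizer and b the column stabilizer with signs.  By the classical
    combinatorial lemma each a g b is 0, c or -c, whence c x c is always a
    multiple of c, and c c = kappa c for a computable integer kappa.  When
    kappa is invertible the ideal is simple, by the trace form of the group
    algebra (specht_mxsimple).  Mapping g to the monomial of the matching M0 g
    is an equivariant map from the group algebra onto MonHaf; being injective
    on any simple ideal whose generator it does not kill, it identifies the
    Specht module with the span of the orbit of the image of c
    (affords_specht).  This image is a multiple of the hafnian for [6], of an
    alternating sum around a four-cycle for [4,2], and of a determinant for
    [2,2,2].  The determinants span the kernel of Phi; the average of the
    four-cycle over the stabilizer of M0 is a combination of Phi M0 and of the
    hafnian, so that the orbits of the four-cycle and of the hafnian together
    span the image of Phi (imageE), and the first spans a space of dimension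
    10 - 1 = 9.

    All identities between explicit vectors hold over the integers; they are
    checked by computation on words, a word being the list of the values of a
    permutation. *)

(** * Permutations of six letters as words *)

Definition word (s : 'S_6) : seq nat := [seq val (s i) | i <- enum 'I_6].
Definition letter (w : seq nat) (i : nat) : nat := nth 0%N w i.
Definition words : seq (seq nat) := Eval vm_compute in permutations (iota 0 6).
Definition mulw (v w : seq nat) : seq nat := map (letter w) v.
Definition oddw (w : seq nat) : bool :=
  odd (count (fun p => letter w p.1 > letter w p.2)%N
             [seq p <- allpairs pair (iota 0 6) (iota 0 6) | p.1 < p.2]%N).

Lemma letter_word s (i : 'I_6) : letter (word s) i = s i.
Proof. by rewrite /letter (nth_map i) ?size_enum_ord // nth_ord_enum. Qed.

Lemma word_inj : injective word.
Proof. by move=> s t E; apply/permP=> i; apply/ord_inj; rewrite -!letter_word E. Qed.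

Lemma wordsE : words = permutations (iota 0 6).
Proof. by vm_compute. Qed.

Lemma word_in s : word s \in words.
Proof.
rewrite wordsE mem_permutations -val_enum_ord /word (map_comp val s).
apply/perm_map/uniq_perm; rewrite ?enum_uniq ?(map_inj_uniq perm_inj) ?enum_uniq //.
by move=> i; rewrite mem_enum; apply/mapP; exists (s^-1%g i); rewrite ?mem_enum ?permKV.
Qed.

Lemma perm_words : perm_eq [seq word s | s <- enum 'S_6] words.
Proof.
have u: uniq [seq word s | s <- enum 'S_6] by rewrite (map_inj_uniq word_inj) enum_uniq.
have uw: uniq words by rewrite wordsE permutations_uniq.
have sub: {subset [seq word s | s <- enum 'S_6] <= words}.
  by move=> w /mapP[s _ ->]; apply: word_in.
apply: (uniq_perm u uw); apply: (uniq_min_size u sub _).2.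
by rewrite size_map -cardE card_Sn wordsE (size_permutations (iota_uniq 0 6)) size_iota leqnn.
Qed.

Lemma all_word (P : pred (seq nat)) : all P words -> forall s, P (word s).
Proof. by move/allP=> h s; apply/h/word_in. Qed.

(** What makes sums over the abstract type 'S_6 computable. *)
Lemma sum_word (V : nmodType) (P : pred (seq nat)) (F : seq nat -> V) :
  \sum_(s : 'S_6 | P (word s)) F (word s) = \sum_(w <- words | P w) F w.
Proof. by rewrite -(perm_big _ perm_words) big_map big_enum_cond. Qed.

Lemma word_surj w : w \in words -> exists s, word s = w.
Proof. by rewrite -(perm_mem perm_words) => /mapP[s _ ->]; exists s. Qed.

Definition perm_word (w : seq nat) : 'S_6 := odflt 1%g [pick s | word s == w].

Lemma word_perm_word w : w \in words -> word (perm_word w) = w.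
Proof.
move/word_surj=> [s Es]; rewrite /perm_word; case: pickP => [t /eqP //|/(_ s)].
by rewrite Es eqxx.
Qed.

Lemma perm_wordK s : perm_word (word s) = s.
Proof. by apply: word_inj; rewrite word_perm_word ?word_in. Qed.

Lemma wordM s t : word (s * t) = mulw (word s) (word t).
Proof. by rewrite /mulw -map_comp; apply: eq_map => i /=; rewrite permM letter_word. Qed.

Lemma mulw_in v w : v \in words -> w \in words -> mulw v w \in words.
Proof. by move=> /word_surj[s <-] /word_surj[t <-]; rewrite -wordM word_in. Qed.

Lemma word1 : word 1 = iota 0 6.
Proof. by rewrite -val_enum_ord; apply: eq_map => i; rewrite perm1. Qed.

Definition tpermw (i j : nat) : seq nat :=
  [seq if k == i then j else if k == j then i else k | k <- iota 0 6].

Lemma word_tperm (i j : 'I_6) : word (tperm i j) = tpermw i j.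
Proof.
rewrite /tpermw -val_enum_ord -map_comp; apply: eq_map => k /=.
rewrite permE /= -!(inj_eq val_inj) /=.
by case: ifP => // _; case: ifP.
Qed.

Definition index_pairs : seq (nat * nat) := [seq (i, j) | i <- iota 0 6, j <- iota 0 6].

Lemma index_pair_in (i j : 'I_6) : (val i, val j) \in index_pairs.
Proof. by apply/allpairsP; exists (val i, val j); rewrite !mem_iota !ltn_ord. Qed.

Lemma index_pairP p : p \in index_pairs -> exists i j : 'I_6, p = (val i, val j).
Proof.
case/allpairsP=> [[i j] []]; rewrite !mem_iota => i6 j6 ->.
by exists (Ordinal i6), (Ordinal j6).
Qed.

(** Checked on all words and all transpositions; with the generation of 'S_6 by
    transpositions it identifies the parity of inversions with odd_perm. *)
Lemma oddw_tperm (i j : 'I_6) t :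
  i != j -> oddw (word (tperm i j * t)) = ~~ oddw (word t).
Proof.
have c: all (fun w => all (fun p => (p.1 == p.2) ||
     (oddw (mulw (tpermw p.1 p.2) w) == ~~ oddw w)) index_pairs) words by vm_compute.
move=> ne; have {c} := allP (all_word c t) _ (index_pair_in i j).
cbv beta =>  /orP[/eqP/val_inj/eqP|/eqP]; first by rewrite (negPf ne).
by rewrite wordM word_tperm.
Qed.

Lemma odd_permE s : odd_perm s = oddw (word s).
Proof.
have [ts -> dts] := prod_tpermP s.
elim: ts dts => [|[i j] ts IH] /=; first by rewrite big_nil odd_perm1 word1.
by case/andP=> ne dts; rewrite big_cons odd_mul_tperm oddw_tperm // ne -IH.
Qed.

(** * Young symmetrizers and the simplicity of Specht modules *)

(** With f the row (resp. column) function of a tableau, these are the words of the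
    row (resp. column) stabilizer. *)
Definition preserves (f : nat -> nat) (w : seq nat) : bool :=
  all (fun i => f (letter w i) == f i) (iota 0 6).

(** Two distinct letters in one row of the tableau are sent into one column: the case
    in which the product of row sum, permutation and signed column sum vanishes. *)
Definition clash (lam : seq nat) (w : seq nat) : bool :=
  has (fun p => [&& p.1 != p.2, reshape_index lam p.1 == reshape_index lam p.2 &
     reshape_offset lam (letter w p.1) == reshape_offset lam (letter w p.2)]) index_pairs.

Definition signw (w : seq nat) : int := if oddw w then -1 else 1.

Definition col_words lam := [seq w <- words | preserves (reshape_offset lam) w].
Definition row_words lam := [seq w <- words | preserves (reshape_index lam) w].

(** The t in C, the column stabilizer, for which w t lies in the row stabilizer. *)
Definition straighten lam C (w : seq nat) : seq (seq nat) :=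
  [seq t <- C | preserves (reshape_index lam) (mulw w t)].

Definition sandwich_coef lam C (w : seq nat) : int :=
  if clash lam w then 0 else signw (head [::] (straighten lam C w)).

Definition sumz (s : seq int) : int := foldr +%R 0 s.

(** The integer kappa for which the Young symmetrizer satisfies c c = kappa c; in
    characteristic 0 it is 720 divided by the dimension of the Specht module. *)
Definition young_square_coef lam : int :=
  let C := col_words lam in
  sumz [seq signw t * sandwich_coef lam C (mulw t s) | t <- C, s <- row_words lam].

(** The dichotomy of the combinatorial lemma for the shape lam. *)
Definition straightens lam : bool :=
  let C := col_words lam in
  all (fun w => clash lam w || (straighten lam C w != [::])) words.

Lemma sumzE s : sumz s = \sum_(x <- s) x.
Proof. by rewrite unlock; elim: s => //= x s ->. Qed.

Lemma preservesP (f : nat -> nat) (s : 'S_6) :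
  preserves f (word s) = [forall i : 'I_6, f (s i) == f i].
Proof.
rewrite /preserves -val_enum_ord all_map; apply/allP/forallP => [h i|h i _ /=].
  by have := h i (mem_enum _ _); rewrite /= letter_word.
by rewrite letter_word h.
Qed.

Lemma straightens_6 : straightens [:: 6]%N. Proof. by vm_compute. Qed.
Lemma straightens_42 : straightens [:: 4; 2]%N. Proof. by vm_compute. Qed.
Lemma straightens_222 : straightens [:: 2; 2; 2]%N. Proof. by vm_compute. Qed.
Lemma young_square_6 : young_square_coef [:: 6]%N = 720. Proof. by vm_compute. Qed.
Lemma young_square_42 : young_square_coef [:: 4; 2]%N = 80. Proof. by vm_compute. Qed.
Lemma young_square_222 : young_square_coef [:: 2; 2; 2]%N = 144. Proof. by vm_compute. Qed.

Section Specht.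

Variables (k : fieldType) (lam : seq nat).
Hypothesis two_neq0 : 2%:R != 0 :> k.
Hypothesis lam_straightens : straightens lam.

Local Notation G := [set: 'S_6].
Local Notation aG := (regular_repr k G).

Definition row_sum := \sum_(s in row_stab lam) aG s.
Definition col_sum := \sum_(t in col_stab lam) (-1) ^+ odd_perm t *: aG t.
Definition young_mx := row_sum *m col_sum.

Lemma aGM (s t : 'S_6) : aG (s * t)%g = aG s *m aG t.
Proof. by rewrite repr_mxM ?inE. Qed.

Lemma in_row_stab s : (s \in row_stab lam) = preserves (reshape_index lam) (word s).
Proof. by rewrite inE preservesP. Qed.

Lemma in_col_stab s : (s \in col_stab lam) = preserves (reshape_offset lam) (word s).
Proof. by rewrite inE preservesP. Qed.

Lemma row_stabM s r : r \in row_stab lam -> ((s * r)%g \in row_stab lam) = (s \in row_stab lam).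
Proof.
rewrite !inE => /forallP hr; apply: eq_forallb => i.
by rewrite permM (eqP (hr _)).
Qed.

Lemma col_stabM s r : r \in col_stab lam -> ((r * s)%g \in col_stab lam) = (s \in col_stab lam).
Proof.
rewrite !inE => /forallP hr; apply/forallP/forallP=> h i.
  by have := h (r^-1%g i); rewrite permM permKV => /eqP->; rewrite -{2}(permKV r i) eq_sym.
by rewrite permM (eqP (h _)).
Qed.

Lemma row_sumM r : r \in row_stab lam -> row_sum *m aG r = row_sum.
Proof.
move=> rR; rewrite mulmx_suml [RHS](reindex_inj (mulIg r)) /=.
by apply: eq_big => [s|s _]; rewrite ?row_stabM ?aGM.
Qed.

Lemma col_sumM t : t \in col_stab lam -> aG t *m col_sum = (-1) ^+ odd_perm t *: col_sum.
Proof.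
move=> tC; rewrite mulmx_sumr scaler_sumr [RHS](reindex_inj (mulgI t)) /=.
apply: eq_big => [s|s _]; first by rewrite col_stabM.
by rewrite -scalemxAr aGM odd_permM signr_addb scalerA signrMK.
Qed.

Lemma gring_row_young : gring_row young_mx = young_symmetrizer k lam.
Proof.
rewrite /young_mx mulmx_suml linear_sum; apply: eq_bigr => s _ /=.
rewrite mulmx_sumr linear_sum; apply: eq_bigr => t _ /=.
by rewrite -scalemxAr linearZ /= -aGM /gring_row rowK gring_indexK ?mul1g ?group1.
Qed.

Lemma signwE (s : 'S_6) : (signw (word s))%:~R = (-1) ^+ odd_perm s :> k.
Proof. by rewrite /signw odd_permE; case: oddw. Qed.

Local Notation C := (col_words lam).

(** In a clash, the transposition of the two letters is absorbed by the row sum with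
    sign +1 and, moved across g, by the column sum with sign -1, so the product is its
    own opposite.  Otherwise g is a row permutation times a column permutation, and
    both are absorbed. *)
Lemma sandwich g : row_sum *m aG g *m col_sum = (sandwich_coef lam C (word g))%:~R *: young_mx.
Proof.
rewrite /sandwich_coef; case: ifPn => [/hasP[p /index_pairP[i [j ->]]] | no_clash].
  rewrite !letter_word; cbn [fst snd]; case/and3P=> ne_ij /eqP row_ij /eqP col_ij.
  have ne : i != j by [].
  rewrite scale0r; set M := _ *m _; apply/eqP.
  suff: 2%:R *: M == 0 by rewrite scaler_eq0 (negPf two_neq0).
  rewrite scaler_nat mulr2n addr_eq0; apply/eqP.
  have tR : tperm i j \in row_stab lam.
    by rewrite inE; apply/forallP=> l; case: tpermP => [->|->|]; rewrite ?row_ij.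
  have tC : tperm (g i) (g j) \in col_stab lam.
    by rewrite inE; apply/forallP=> l; case: tpermP => [->|->|]; rewrite ?col_ij.
  rewrite {1}/M -(row_sumM tR) -[_ *m aG g]mulmxA -aGM.
  have -> : (tperm i j * g)%g = (g * tperm (g i) (g j))%g.
    by rewrite -tpermJ conjgE !mulgA mulgV mul1g.
  rewrite aGM -!mulmxA col_sumM // odd_tperm (inj_eq perm_inj) ne expr1 scaleN1r.
  by rewrite !mulmxN /M mulmxA.
have /orP[/idPn//|] := allP lam_straightens _ (word_in g).
set t := head [::] _ => nz.
have : t \in straighten lam C (word g).
  by rewrite /t; case: (straighten _ _ _) nz => //= *; rewrite mem_head.
rewrite !mem_filter => /and3P[tR tC /word_surj[t' Et]].
have tC' : t' \in col_stab lam by rewrite in_col_stab Et.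
have tR' : (g * t')%g \in row_stab lam by rewrite in_row_stab wordM Et.
rewrite -Et signwE -[g in LHS](mulgK t') aGM mulmxA (row_sumM tR') -mulmxA.
rewrite col_sumM ?odd_permV -?scalemxAr //.
rewrite inE; apply/forallP => i; move: tC'; rewrite inE => /forallP/(_ (t'^-1%g i)).
by rewrite permKV eq_sym.
Qed.

Lemma young_mx2 : young_mx *m young_mx = (young_square_coef lam)%:~R *: young_mx.
Proof.
have -> : young_mx *m young_mx = \sum_(t in col_stab lam) \sum_(s in row_stab lam)
    (-1) ^+ odd_perm t *: (row_sum *m aG (t * s)%g *m col_sum).
  rewrite /young_mx mulmxA -[_ *m col_sum *m row_sum]mulmxA.
  have -> : col_sum *m row_sum = \sum_(t in col_stab lam) \sum_(s in row_stab lam)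
      (-1) ^+ odd_perm t *: aG (t * s)%g.
    rewrite /col_sum /row_sum mulmx_suml; apply: eq_bigr => t _.
    by rewrite mulmx_sumr; apply: eq_bigr => s _; rewrite -scalemxAl -aGM.
  move: row_sum col_sum => r c; rewrite mulmx_sumr mulmx_suml; apply: eq_bigr => t _.
  rewrite mulmx_sumr mulmx_suml; apply: eq_bigr => s _.
  by rewrite -scalemxAr -scalemxAl.
rewrite /young_square_coef sumzE big_allpairs_dep /= rmorph_sum scaler_suml /=.
rewrite big_filter -(sum_word (preserves (reshape_offset lam))
  (fun v => (\sum_(w <- row_words lam)
     signw v * sandwich_coef lam C (mulw v w))%:~R *: young_mx)).
apply: eq_big => [t|t _]; first by rewrite in_col_stab.
rewrite rmorph_sum scaler_suml /= big_filter.
rewrite -(sum_word (preserves (reshape_index lam))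
  (fun v => (signw (word t) * sandwich_coef lam C (mulw (word t) v))%:~R *: young_mx)).
apply: eq_big => [s|s _]; first by rewrite in_row_stab.
by rewrite sandwich -wordM scalerA rmorphM /= signwE.
Qed.

(** The trace form of the group algebra, up to the factor 720 which is not invertible
    in all the characteristics at stake. *)
Definition coef1 (A : 'M[k]_#|G|) : k := gring_row A 0 (gring_index G 1).

Lemma coef1_is_linear : scalar coef1.
Proof. by move=> c A B; rewrite /coef1 linearP !mxE. Qed.
HB.instance Definition _ := GRing.isLinear.Build k _ _ _ coef1 coef1_is_linear.

Lemma gring_row_aG g : gring_row (aG g) = delta_mx 0 (gring_index G g).
Proof. by rewrite /gring_row rowK gring_indexK ?mul1g ?group1. Qed.

Lemma gring_index_inj : injective (gring_index G).
Proof. by move=> g h /(congr1 enum_val); rewrite !gring_indexK ?inE. Qed.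

Lemma coef1_aG g : coef1 (aG g) = (g == 1%g)%:R.
Proof. by rewrite /coef1 gring_row_aG !mxE eqxx (inj_eq gring_index_inj) eq_sym. Qed.

Lemma group_ring_sum A : (A \in group_ring k G)%MS ->
  A = \sum_g gring_row A 0 (gring_index G g) *: aG g.
Proof.
case/envelop_mxP=> a defA; rewrite {1}defA (eq_bigl xpredT) => [|g]; last by rewrite !inE.
apply: eq_bigr => g _; congr (_ *: _); rewrite defA linear_sum summxE.
rewrite (eq_bigl xpredT) => [|h]; last by rewrite !inE.
rewrite (bigD1 g) //= linearZ /= gring_row_aG !mxE !eqxx mulr1 big1 ?addr0 // => h ne.
by rewrite linearZ /= gring_row_aG !mxE (inj_eq gring_index_inj) eq_sym (negPf ne) mulr0.
Qed.

Lemma coef1C A B : (A \in group_ring k G)%MS -> (B \in group_ring k G)%MS ->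
  coef1 (A *m B) = coef1 (B *m A).
Proof.
move=> /group_ring_sum-> /group_ring_sum->.
rewrite mulmx_suml mulmx_sumr !linear_sum; apply: eq_bigr => g _ /=.
rewrite mulmx_suml mulmx_sumr !linear_sum; apply: eq_bigr => h _ /=.
rewrite -!(scalemxAl, scalemxAr) !linearZ /= -!aGM !coef1_aG.
rewrite mulrCA; congr (_ * (_ * (nat_of_bool _)%:R)).
have comm1 (x y : 'S_6) : (x * y = 1 -> y * x = 1)%g.
  by move/eqP; rewrite -eq_invg_mul => /eqP<-; rewrite mulVg.
by apply/eqP/eqP; apply: comm1.
Qed.

Lemma aG_in g : (aG g \in group_ring k G)%MS.
Proof. by rewrite envelop_mx_id ?inE. Qed.

Lemma young_mx_in : (young_mx \in group_ring k G)%MS.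
Proof.
apply: envelop_mxM; rewrite linear_sum summx_sub //= => s _; first exact: aG_in.
by rewrite linearZ scalemx_sub //; exact: aG_in.
Qed.

Lemma row_col_sandwich A : (A \in group_ring k G)%MS ->
  exists c : k, row_sum *m A *m col_sum = c *: young_mx.
Proof.
move=> /group_ring_sum->.
exists (\sum_g gring_row A 0 (gring_index G g) * (sandwich_coef lam C (word g))%:~R).
rewrite scaler_suml -(eq_bigr _ (fun g _ => scalerA _ _ _)).
rewrite -(eq_bigr _ (fun g _ => congr1 _ (sandwich g))).
move: row_sum col_sum (gring_row A) => r c u.
rewrite mulmx_sumr mulmx_suml; apply: eq_bigr => g _.
by rewrite -scalemxAr -scalemxAl.
Qed.

Hypothesis young_square_neq0 : (young_square_coef lam)%:~R != 0 :> k.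

Hypothesis young_neq0 : young_symmetrizer k lam != 0.

(** Let U = c A be nonzero in a submodule V.  Some translate U g has a nonzero
    coefficient at 1, and since c U = kappa U and the form is symmetric, the
    coefficient of U g c at 1 is kappa times it, hence nonzero.  But U g c = c (A g) c is
    a multiple of c, so c lies in V.  Semisimplicity of the group algebra is not assumed,
    which covers [2,2,2] in characteristic 5. *)
Lemma specht_mxsimple : mxsimple aG (specht_mx k lam).
Proof.
rewrite /specht_mx -gring_row_young; split; first exact: cyclic_mx_module.
  by rewrite cyclic_mx_eq0 gring_row_young young_neq0.
move=> V modV sVS nzV; apply: cyclic_mx_sub => //.
set v := nz_row V; have Vv : (v <= V)%MS by apply: nz_row_sub.
have nzv : v != 0 by rewrite nz_row_eq0.
have /cyclic_mxP[A RA defv] := submx_trans Vv sVS.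
set U := young_mx *m A; have defv' : v = gring_row U by rewrite gring_row_mul.
have YU : young_mx *m U = (young_square_coef lam)%:~R *: U.
  by rewrite /U mulmxA young_mx2 -scalemxAl.
have RU : (U \in group_ring k G)%MS by apply: envelop_mxM; rewrite ?young_mx_in.
have [g nzg] : exists g, coef1 (U *m aG g) != 0.
  have [i nzi] : exists i, v 0 i != 0 by apply/rV0Pn.
  exists (enum_val i)^-1%g; rewrite (group_ring_sum RU) mulmx_suml linear_sum /=.
  rewrite (bigD1 (enum_val i)) //= big1 ?addr0 => [|h ne].
    by rewrite -scalemxAl linearZ /= -aGM mulgV coef1_aG eqxx mulr1 gring_valK -defv'.
  by rewrite -scalemxAl linearZ /= -aGM coef1_aG -eq_mulgV1 (negPf ne) mulr0.
have [c Ec] : exists c, U *m aG g *m young_mx = c *: young_mx.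
  rewrite /U /young_mx -!mulmxA mulmxA -mulmxA.
  rewrite [X in row_sum *m X](_ : _ = (col_sum *m A *m aG g *m row_sum) *m col_sum);
    last by rewrite !mulmxA.
  rewrite mulmxA; apply: row_col_sandwich; do !apply: envelop_mxM => //.
  - rewrite linear_sum summx_sub //= => s _; by rewrite linearZ scalemx_sub //; exact: aG_in.
  - exact: aG_in.
  - rewrite linear_sum summx_sub //= => s _; exact: aG_in.
have nzc : c != 0.
  apply: contraNneq nzg => c0; move: Ec; rewrite c0 scale0r => UgY.
  have := coef1C (envelop_mxM RU (aG_in g)) young_mx_in.
  rewrite UgY linear0 mulmxA YU -scalemxAl linearZ /= => /esym/eqP.
  by rewrite mulf_eq0 (negPf young_square_neq0).
have -> : gring_row young_mx = c^-1 *: (v *m (aG g *m young_mx)).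
  by rewrite defv' -gring_row_mul mulmxA Ec linearZ scalerA mulVf // scale1r.
apply: scalemx_sub; apply: (mxmodule_envelop modV) => //.
by apply: envelop_mxM; rewrite ?aG_in ?young_mx_in.
Qed.

End Specht.

(** * Orbits of forms and copies of Specht modules *)

Section Orbits.
Variable k : fieldType.

Local Notation G := [set: 'S_6].
Local Notation aG := (regular_repr k G).

Lemma sact_is_linear d s : linear (@sact k d s).
Proof. by move=> c p q; apply/val_inj; rewrite /= linearP. Qed.
HB.instance Definition _ d s :=
  GRing.isLinear.Build k (forms k d) (forms k d) _ (@sact k d s) (@sact_is_linear d s).

Lemma sact1 d (F : forms k d) : sact 1 F = F.
Proof.
apply/val_inj; rewrite /= -[RHS](comp_mpoly_id (val F)) /=; congr (_ \mPo _).
by apply: eq_from_tnth => v; rewrite !tnth_mktuple !perm1 /x_ varK.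
Qed.

Definition orbit_span d (F : forms k d) : {vspace forms k d} :=
  <<[seq sact s F | s : 'S_6]>>%VS.

Lemma mem_orbit_span d (F : forms k d) s : sact s F \in orbit_span F.
Proof. by apply: memv_span; apply: image_f. Qed.

Lemma orbit_span_id d (F : forms k d) : F \in orbit_span F.
Proof. by rewrite -{1}(sact1 F) mem_orbit_span. Qed.

Lemma sub_orbit_span d (F : forms k d) (W : {vspace forms k d}) :
  (forall s, sact s F \in W) -> (orbit_span F <= W)%VS.
Proof. by move=> h; apply/span_subvP=> _ /imageP[s _ ->]. Qed.

Lemma orbit_span_stable d (F H : forms k d) s :
  H \in orbit_span F -> sact s H \in orbit_span F.
Proof.
have sub : (linfun (@sact k d s) @: orbit_span F <= orbit_span F)%VS.
  rewrite limg_span; apply/span_subvP=> _ /mapP[_ /imageP[t _ ->] ->].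
  by rewrite lfunE /= -sactM mem_orbit_span.
by move=> /(memv_img (linfun (@sact k d s)))/(subvP sub); rewrite lfunE.
Qed.

Lemma orbit_spanS d (F H : forms k d) :
  H \in orbit_span F -> (orbit_span H <= orbit_span F)%VS.
Proof. by move=> h; apply: sub_orbit_span => s; exact: orbit_span_stable. Qed.

Lemma haf_monomialM s t : haf_monomial k (s * t) = sact t (haf_monomial k s).
Proof.
apply/val_inj; rewrite /= rmorph_prod /=; apply: eq_bigr => i _.
by rewrite !permM; apply/esym/x_perm.
Qed.

Lemma haf_monomialE s : haf_monomial k s = sact s (haf_monomial k 1).
Proof. by rewrite -haf_monomialM mul1g. Qed.

Lemma MonHafE : MonHaf k = orbit_span (haf_monomial k 1).
Proof.
rewrite /MonHaf /orbit_span; congr (<<_>>%VS).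
by apply: eq_map => s; rewrite haf_monomialE.
Qed.

(** The equivariant map from the regular representation to MonHaf that sends 1 to the
    monomial of the matching M0. *)
Definition orbit_map (u : 'rV[k]_#|G|) : forms k 3 :=
  \sum_g u 0 (gring_index G g) *: haf_monomial k g.

Lemma orbit_map_is_linear : linear orbit_map.
Proof.
move=> c u v; rewrite /orbit_map scaler_sumr -big_split; apply: eq_bigr => g _ /=.
by rewrite !mxE scalerDl scalerA.
Qed.
HB.instance Definition _ :=
  GRing.isLinear.Build k _ (forms k 3) _ orbit_map orbit_map_is_linear.

Lemma orbit_map_delta g : orbit_map (delta_mx 0 (gring_index G g)) = haf_monomial k g.
Proof.
rewrite /orbit_map (bigD1 g) //= !mxE !eqxx scale1r big1 ?addr0 // => h ne.
rewrite mxE (can_in_eq (gring_indexK (G:=[group of G]))) ?inE //.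
by rewrite (negPf ne) scale0r.
Qed.

Lemma orbit_mapM u g : orbit_map (u *m aG g) = sact g (orbit_map u).
Proof.
rewrite [u in LHS]row_sum_delta mulmx_suml !linear_sum /=.
rewrite (reindex_onto (gring_index G) enum_val) /=; last first.
  by move=> i _; rewrite gring_valK.
rewrite (eq_bigl xpredT) => [|h]; last by rewrite gring_indexK ?inE ?eqxx.
apply: eq_bigr => h _; rewrite -scalemxAl !linearZ /= -rowE rowK gring_indexK ?inE //.
by rewrite orbit_map_delta haf_monomialM.
Qed.

Lemma orbit_map_group_ring u A : (A \in group_ring k G)%MS ->
  orbit_map (u *m A) \in orbit_span (orbit_map u).
Proof.
case/envelop_mxP=> a ->; rewrite mulmx_sumr linear_sum memv_suml // => g _.
by rewrite -scalemxAr linearZ memvZ //= orbit_mapM mem_orbit_span.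
Qed.

(** By simplicity the kernel of orbit_map meets the Specht module trivially, so the
    basis in which specht_repr is written is carried to a basis of the orbit span. *)
Lemma affords_specht lam (c := orbit_map (young_symmetrizer k lam)) :
    mxsimple aG (specht_mx k lam) -> c != 0 ->
  affords (orbit_span c) (specht_repr k lam)
    /\ \dim (orbit_span c) = \rank (specht_mx k lam).
Proof.
move=> simS nzc; set S := specht_mx k lam.
have cS : (young_symmetrizer k lam <= S)%MS by apply: cyclic_mx_id.
(* The kernel of orbit_map in S is a submodule, given by a matrix K in coordinates. *)
have injS (u : 'rV_#|G|) : (u <= S)%MS -> orbit_map u = 0 -> u = 0.
  pose crd (w : 'rV[k]_#|G|) := \row_i coord (vbasis {:forms k 3}) i (orbit_map w).
  have crd_lin : linear crd by move=> a w w'; apply/rowP=> i; rewrite !mxE !linearP.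
  pose f : {linear 'rV[k]_#|G| -> 'rV[k]__} := HB.pack crd (GRing.isLinear.Build _ _ _ _ _ crd_lin).
  pose K := (S :&: kermx (lin1_mx f))%MS.
  have inK (w : 'rV_#|G|) : (w <= K)%MS = (w <= S)%MS && (orbit_map w == 0).
    rewrite sub_capmx; congr (_ && _); apply/sub_kermxP/eqP; rewrite mul_rV_lin1 /= => E.
      rewrite (coord_vbasis (memvf (orbit_map w))) big1 // => i _.
      by move/rowP/(_ i): E; rewrite !mxE => ->; rewrite scale0r.
    by apply/rowP=> i; rewrite !mxE E linear0.
  have modK : mxmodule aG K.
    apply/mxmoduleP=> g _; apply/row_subP => i; rewrite row_mul.
    have := row_sub i K; rewrite !inK => /andP[sS /eqP E].
    by rewrite orbit_mapM E linear0 eqxx andbT (mxmodule_trans _ _ sS) ?inE //; case: simS.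
  move=> uS u0; have [->//|nzu] := eqVneq u 0.
  have uK : (u <= K)%MS by rewrite inK uS u0 eqxx.
  have nzK : K != 0 by apply: contraNneq nzu => K0; rewrite -submx0 -K0.
  case: simS => _ _ /(_ K modK (capmxSl _ _) nzK) SK.
  by have := submx_trans cS SK; rewrite inK -/c (negPf nzc) andbF.
pose bas (i : 'I_(\rank S)) := row i (val_submod (1%:M : 'M_(\rank S))).
have basS i : (bas i <= S)%MS by rewrite (submx_trans (row_sub _ _)) // val_submodP.
have combE (x : 'rV_(\rank S)) : \sum_i x 0 i *: orbit_map (bas i) = orbit_map (val_submod x).
  rewrite val_submodE mulmx_sum_row linear_sum; apply: eq_bigr => i _; by rewrite linearZ.
pose b := [tuple orbit_map (bas i) | i < \rank S].
have free_b : free b.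
  apply/freeP => x; under eq_bigr => i _ do rewrite -tnth_nth tnth_mktuple.
  move=> x0 i; have := combE (\row_i x i); under eq_bigr => j _ do rewrite mxE.
  rewrite x0 => /esym/(injS _ (val_submodP _))/eqP; rewrite val_submod_eq0 => /eqP/rowP/(_ i).
  by rewrite !mxE.
have span_b : <<b>>%VS = orbit_span c.
  apply/eqP; rewrite eqEsubv; apply/andP; split.
    apply/span_subvP=> _ /mapP[i _ ->].
    by have /cyclic_mxP[A RA ->] := basS i; apply: orbit_map_group_ring.
  apply: sub_orbit_span => s; rewrite -orbit_mapM.
  have sS : (young_symmetrizer k lam *m aG s <= S)%MS.
    by apply: mxmodule_trans => //; rewrite ?inE //; case: simS.
  rewrite -(in_submodK sS) -combE memv_suml // => i _; apply/memvZ/memv_span.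
  by apply/mapP; exists i; rewrite ?mem_enum.
have basis_b : basis_of (orbit_span c) b by rewrite /basis_of span_b eqxx free_b.
split; last by rewrite -span_b (eqP free_b) size_tuple.
exists b => // s i; rewrite tnth_mktuple -orbit_mapM.
have -> : bas i *m aG s = val_submod (row i (specht_repr k lam s)).
  have e : (val_submod (1%:M : 'M_(\rank S)) *m aG s <= S)%MS.
    by apply: mxmodule_trans; rewrite ?inE ?val_submodP //; case: simS.
  by rewrite /bas -row_mul -{1}(in_submodK e) [LHS]row_mul.
rewrite -combE; apply: eq_bigr => j _; by rewrite tnth_mktuple mxE.
Qed.

End Orbits.

(** * Equivariance of differentiation *)

Definition var_act (s : 'S_6) (v : 'I_21) : 'I_21 := var (s (var_fst v)) (s (var_snd v)).

Lemma var_act_var s i j : var_act s (var i j) = var (s i) (s j).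
Proof.
rewrite /var_act; have := var_fst_snd i j; by case: ifP => _ [-> ->]; [|rewrite varC].
Qed.

Lemma var_act_inj s : injective (var_act s).
Proof.
apply: (can_inj (g := var_act s^-1)) => v.
by rewrite {2}/var_act var_act_var !permK varK.
Qed.

Section Equivariance.
Variable k : fieldType.

Lemma tnth_perm_var s v : tnth (perm_tuple k s) v = 'X_(var_act s v).
Proof. by rewrite tnth_mktuple. Qed.

Lemma comp_permX s v : 'X_v \mPo perm_tuple k s = 'X_(var_act s v).
Proof. by rewrite comp_mpolyXU -tnth_nth tnth_perm_var. Qed.

(** Both sides are derivations along the substitution in F, and they agree on the
    variables. *)
Lemma mderiv_comp_perm s v (F : {mpoly k[21]}) :
  F^`M(v) \mPo perm_tuple k s = (F \mPo perm_tuple k s)^`M(var_act s v).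
Proof.
pose Q (H : {mpoly k[21]}) :=
  H^`M(v) \mPo perm_tuple k s = (H \mPo perm_tuple k s)^`M(var_act s v).
have Q1 : Q 1 by rewrite /Q rmorph1 -mpolyC1 !mderivC raddf0.
have QM p q : Q p -> Q q -> Q (p * q).
  by rewrite /Q mderivM rmorphD !rmorphM mderivM /= => -> ->.
have subU (w : 'I_21) : (U_(w) - U_(w) = 0)%MM by rewrite -{1}[U_(w)%MM]add0m addmK.
have QX i : Q 'X_i.
  rewrite /Q comp_permX !mderivX !mnm1E (inj_eq (@var_act_inj s)).
  case: eqP => [->|_]; last by rewrite !scale0r raddf0.
  by rewrite !scale1r !subU mpolyX0 rmorph1.
have QXm m : Q 'X_[m].
  rewrite mpolyXE_id; apply: (big_ind Q Q1 QM) => i _.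
  elim: (m i) => [|d IH]; first by rewrite expr0.
  by rewrite exprS; exact: QM.
elim/mpolyind: F => [|c m p _ _]; first by rewrite raddf0 linear0 raddf0.
rewrite mderivD mderivZ !comp_mpolyD !comp_mpolyZ mderivD mderivZ => ->.
by have := QXm m; rewrite /Q => ->.
Qed.

Lemma diff_actX m (F : {mpoly k[21]}) : diff_act 'X_[m] F = F^`M[m].
Proof. by rewrite /diff_act msuppX big_seq1 mcoeffX eqxx scale1r. Qed.

Lemma diff_act_comp_perm s (h F : {mpoly k[21]}) :
  diff_act h F \mPo perm_tuple k s
  = diff_act (h \mPo perm_tuple k s) (F \mPo perm_tuple k s).
Proof.
pose Q m := exists2 m', 'X_[m] \mPo perm_tuple k s = 'X_[m'] &
  forall H : {mpoly k[21]}, H^`M[m] \mPo perm_tuple k s = (H \mPo perm_tuple k s)^`M[m'].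
have Q0 : Q 0%MM.
  by exists 0%MM => [|H]; rewrite ?mpolyX0 ?rmorph1 // !mderivm0m.
have QD m1 m2 : Q m1 -> Q m2 -> Q (m1 + m2)%MM.
  move=> [m1' X1 D1] [m2' X2 D2]; exists (m1' + m2')%MM => [|H].
    by rewrite !mpolyXD rmorphM /= X1 X2.
  by rewrite !mderivmDm D2 D1.
have QU i : Q U_(i)%MM.
  exists U_(var_act s i)%MM => [|H]; first exact: comp_permX.
  by rewrite !mderivmU1m mderiv_comp_perm.
have Qm m : Q m.
  rewrite [m]multinomUE_id; elim/big_ind: _ => // i _.
  by elim: (m i) => [|d IH]; rewrite ?mulm0n // mulmS; apply: QD.
have lin (c : k) p q H : diff_act (c *: p + q) H = c *: diff_act p H + diff_act q H.
  exact: diff_act_linear.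
elim/mpolyind: h => [|c m p _ _ IH].
  by rewrite comp_mpoly0 /diff_act msupp0 !big_nil comp_mpoly0.
rewrite lin !comp_mpolyD !comp_mpolyZ lin IH; congr (_ *: _ + _).
by have [m' Xm Dm] := Qm m; rewrite Xm !diff_actX Dm.
Qed.

Lemma sact_apolar s d e (F : forms k (d + e)) h :
  sact s F = F -> sact s (apolar F h) = apolar F (sact s h).
Proof.
move=> sF; apply/val_inj; rewrite /= !apolarE diff_act_comp_perm.
by rewrite -[in RHS]sF.
Qed.

(** The permanent (b = false) and the determinant (b = true), treated at once. *)
Definition signed_perm (b : bool) : {mpoly k[21]} :=
  \sum_(t : 'S_6) (-1) ^+ (b && odd_perm t) * \prod_i x_ k i (t i).

Lemma permanentE : permanent (X k) = signed_perm false.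
Proof. by apply: eq_bigr => t _; rewrite mul1r; apply: eq_bigr => i _; rewrite mxE. Qed.

Lemma determinantE : \det (X k) = signed_perm true.
Proof. by apply: eq_bigr => t _; congr (_ * _); apply: eq_bigr => i _; rewrite mxE. Qed.

(** Conjugating the summation index by s preserves its sign. *)
Lemma signed_perm_inv b s : signed_perm b \mPo perm_tuple k s = signed_perm b.
Proof.
rewrite rmorph_sum [RHS](reindex_inj (conjg_inj s)) /=.
apply: eq_bigr => t _; rewrite odd_permJ rmorphM rmorphXn rmorphN rmorph1; congr (_ * _).
rewrite rmorph_prod [RHS](reindex_inj (@perm_inj _ s)) /=.
by apply: eq_bigr => i _; rewrite x_perm permJ.
Qed.

Lemma sact_Phi s h : sact s (Phi k h) = Phi k (sact s h).
Proof.
by apply: sact_apolar; apply/val_inj; rewrite /= permanentE signed_perm_inv.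
Qed.

Lemma sact_Psi s h : sact s (Psi k h) = Psi k (sact s h).
Proof.
by apply: sact_apolar; apply/val_inj; rewrite /= determinantE signed_perm_inv.
Qed.

End Equivariance.

(** * Monomials as lists of variables *)

Definition var_index (i j : nat) : nat := index (minn i j, maxn i j) upairs.
Definition mon (L : seq nat) : 'X_{1..21} := (\sum_(v <- L) U_(inord v))%MM.

(** The variables of the hafnian monomial of w; sorting makes this list a normal form
    of the matching. *)
Definition key (w : seq nat) : seq nat :=
  sort leq [seq var_index (letter w p.1) (letter w p.2) | p <- [:: (0, 1); (2, 3); (4, 5)]]%N.
(** The variables of the term of the permanent indexed by w. *)
Definition factors (w : seq nat) : seq nat :=
  [seq var_index i (letter w i) | i <- iota 0 6].

Definition weight (K : seq nat) (T : seq (int * seq nat)) : int :=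
  sumz [seq p.1 | p <- T & p.2 == K].

(** Differentiating the monomial with factors E along the monomial with factors L gives
    the coefficient and the remaining factors. *)
Fixpoint derive_factors (L E : seq nat) : nat * seq nat :=
  if L is v :: L' then
    let: (c, E') := derive_factors L' (rem v E) in (count_mem v E * c, E')%N
  else (1%N, E).

Lemma varE i j : var i j = inord (var_index i j). Proof. by []. Qed.

Lemma mon_cons v L : mon (v :: L) = (U_(inord v) + mon L)%MM.
Proof. by rewrite /mon big_cons. Qed.

Lemma perm_mon L L' : perm_eq L L' -> mon L = mon L'.
Proof. exact: perm_big. Qed.

Lemma monE L (v : 'I_21) : all (gtn 21) L -> mon L v = count_mem (v : nat) L.
Proof.
elim: L => [|u L IH] /=; first by rewrite /mon big_nil mnm0E.
case/andP=> u21 L21; rewrite mon_cons mnmDE mnm1E IH //; congr (nat_of_bool _ + _)%N.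
by rewrite -(inj_eq val_inj) /= inordK.
Qed.

Lemma mon_inj L L' : all (gtn 21) L -> all (gtn 21) L' -> sorted leq L -> sorted leq L' ->
  mon L = mon L' -> L = L'.
Proof.
move=> L21 L21' sL sL' E; apply: (sorted_eq leq_trans anti_leq sL sL').
apply/allP=> v; rewrite mem_cat => vL; apply/eqP.
have v21 : (v < 21)%N by case/orP: vL => [/(allP L21)|/(allP L21')].
by rewrite -!(monE (Ordinal v21)) // E.
Qed.

Lemma sum_by_key (V : zmodType) (T : seq (int * seq nat)) (Ks : seq (seq nat)) (g : seq nat -> V) :
  uniq Ks -> all (fun p => p.2 \in Ks) T ->
  \sum_(p <- T) g p.2 *~ p.1 = \sum_(K <- Ks) g K *~ weight K T.
Proof.
move=> uK /allP inK.
under [RHS]eq_bigr => K _ do rewrite /weight sumzE big_map big_filter mulrz_sumr.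
rewrite (exchange_big_dep xpredT) //= big_seq [RHS]big_seq; apply: eq_bigr => p pT.
rewrite big_mkcond (bigD1_seq p.2) ?inK //= eqxx big1 ?addr0 // => K.
by rewrite eq_sym => /negPf->.
Qed.

Section Polys.
Variable k : fieldType.

Definition poly_of (T : seq (int * seq nat)) : {mpoly k[21]} :=
  \sum_(p <- T) 'X_[mon p.2] *~ p.1.

Lemma mderiv_mon E v : all (gtn 21) E -> (v < 21)%N ->
  ('X_[mon E] : {mpoly k[21]})^`M(inord v) = 'X_[mon (rem v E)] *+ count_mem v E.
Proof.
move=> E21 v21; rewrite mderivX monE // inordK // -scaler_nat.
have [vE | /count_memPn->] := boolP (v \in E); last by rewrite !scale0r.
by congr (_ *: 'X_[_]); rewrite (perm_mon (perm_to_rem vE)) mon_cons addmC addmK.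
Qed.

Lemma mderivm_mon L E : all (gtn 21) L -> all (gtn 21) E ->
  ('X_[mon E] : {mpoly k[21]})^`M[mon L] =
    'X_[mon (derive_factors L E).2] *+ (derive_factors L E).1.
Proof.
elim: L E => [|v L IH] E /=; first by rewrite /mon big_nil mderivm0m.
case/andP=> v21 L21 E21; rewrite mon_cons mderivmDm mderivmU1m mderiv_mon //.
rewrite mderivmMn IH //=; last by apply/allP=> u /mem_rem/(allP E21).
by case: (derive_factors L _) => c E' /=; rewrite -mulrnA mulnC.
Qed.

Lemma mpolyX_mon L : 'X_[mon L] = \prod_(v <- L) 'X_(inord v) :> {mpoly k[21]}.
Proof. exact: (big_morph _ (@mpolyXD _ _) (@mpolyX0 _ _)). Qed.

Lemma prod_x_mon (s : 'S_6) : \prod_i x_ k i (s i) = 'X_[mon (factors (word s))].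
Proof.
rewrite mpolyX_mon /factors -val_enum_ord -map_comp big_map big_enum /=.
by apply: eq_bigr => i _; rewrite /x_ varE letter_word.
Qed.

Lemma haf_mon s : haf_monomial k s = 'X_[mon (key (word s))] :> {mpoly k[21]}.
Proof.
have letterE i : (i < 6)%N -> letter (word s) i = s (inord i).
  by move=> i6; rewrite -{1}(inordK i6) letter_word.
transitivity (\prod_(t < 3) 'X_(var (s (inord t.*2)) (s (inord t.*2.+1))) : {mpoly k[21]}).
  by [].
rewrite /key (perm_mon (permEl (perm_sort _ _))) mpolyX_mon big_map.
by rewrite !big_cons big_nil !big_ord_recl big_ord0 !varE !letterE.
Qed.

End Polys.

(** * Integral combinations of hafnian monomials *)

(** A list of pairs (c, w) stands for an element of the integral group algebra, and
    also for its image in MonHaf, the combination of the monomials of the M0 w. *)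
Definition formal := seq (int * seq nat).
Definition fmul (S T : formal) : formal :=
  [seq (p.1 * q.1, mulw p.2 q.2) | p <- S, q <- T].
Definition fscale (c : int) (S : formal) : formal := [seq (c * p.1, p.2) | p <- S].
Definition fconst (c : int) (ws : seq (seq nat)) : formal := [seq (c, w) | w <- ws].
Definition keyed (S : formal) : formal := [seq (p.1, key p.2) | p <- S].
Definition valid (S : formal) : bool := all (fun p => p.2 \in words) S.

Definition base_word : seq nat := iota 0 6.
(** One word for each matching that shares exactly one edge with M0 = {01, 23, 45}. *)
Definition one_common : seq (seq nat) :=
  [:: [:: 0; 1; 2; 4; 3; 5]; [:: 0; 1; 2; 5; 3; 4]; [:: 0; 2; 1; 3; 4; 5];
      [:: 0; 3; 1; 2; 4; 5]; [:: 0; 4; 1; 5; 2; 3]; [:: 0; 5; 1; 4; 2; 3]]%N.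
(** One word for each matching that shares no edge with M0. *)
Definition none_common : seq (seq nat) :=
  [:: [:: 0; 2; 1; 4; 3; 5]; [:: 0; 2; 1; 5; 3; 4]; [:: 0; 3; 1; 4; 2; 5];
      [:: 0; 3; 1; 5; 2; 4]; [:: 0; 4; 1; 2; 3; 5]; [:: 0; 4; 1; 3; 2; 5];
      [:: 0; 5; 1; 2; 3; 4]; [:: 0; 5; 1; 3; 2; 4]]%N.
Definition matchings := base_word :: one_common ++ none_common.
Definition keys : seq (seq nat) := map key matchings.
Definition vec (T : formal) : seq int := [seq weight K T | K <- keys].
Definition coords (S : formal) : seq int := vec (keyed S).

Definition base_f : formal := [:: (1, base_word)].
Definition hafnian_f : formal := fconst 1 matchings.
(** The coefficient of M is 2 ^ c with c the number of components of M0 + M.  A component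
    is an edge taken twice or an even cycle, so the permutation has one cycle for each
    component and sign (-1) ^ c, which gives the signs of Psi_f. *)
Definition Phi_f : formal :=
  fconst 8 [:: base_word] ++ fconst 4 one_common ++ fconst 2 none_common.
Definition Psi_f : formal :=
  fconst (-8) [:: base_word] ++ fconst 4 one_common ++ fconst (-2) none_common.
Definition contract_f (b : bool) := if b then Psi_f else Phi_f.

(** The terms of the derivative along M0 of the permanent or determinant. *)
Definition expansion (b : bool) : formal :=
  [seq p <-
    [seq ((if b && oddw w then -1 else 1) * (derive_factors (key base_word) (factors w)).1%:Z,
     sort leq (derive_factors (key base_word) (factors w)).2) | w <- words] | p.1 != 0].

Lemma expansion_keys b : all (fun p => p.2 \in keys) (expansion b).
Proof. by case: b; vm_compute. Qed.
Lemma expansion_vec b : vec (expansion b) = coords (contract_f b).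
Proof. by case: b; vm_compute. Qed.
Lemma key_in w : w \in words -> key w \in keys.
Proof. by move: w; apply/allP; vm_compute. Qed.
Lemma keys_uniq : uniq keys. Proof. by vm_compute. Qed.
Lemma keys_wf : all (fun K => all (gtn 21) K && sorted leq K) keys. Proof. by vm_compute. Qed.
Lemma matchings_in w : w \in matchings -> w \in words.
Proof. by move: w; apply/allP; vm_compute. Qed.

Lemma valid_fmul S T : valid S -> valid T -> valid (fmul S T).
Proof.
move=> /allP vS /allP vT; apply/allP => _ /allpairsP[[p q] [pS qT ->]].
exact: mulw_in (vS _ pS) (vT _ qT).
Qed.

Lemma valid_cat S T : valid (S ++ T) = valid S && valid T.
Proof. exact: all_cat. Qed.

Lemma valid_fscale c S : valid (fscale c S) = valid S.
Proof. by rewrite /valid all_map. Qed.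

Lemma valid_fconst c ws : {subset ws <= words} -> valid (fconst c ws).
Proof. by move=> h; rewrite /valid all_map; apply/allP=> w /h. Qed.

Section Eval.
Variable k : fieldType.

Definition formal_eval (T : formal) : forms k 3 :=
  \sum_(p <- T) haf_monomial k (perm_word p.2) *~ p.1.

Local Notation ev := formal_eval.

Lemma poly_of_eq T1 T2 : all (fun p => p.2 \in keys) T1 -> all (fun p => p.2 \in keys) T2 ->
  vec T1 = vec T2 -> poly_of k T1 = poly_of k T2.
Proof.
move=> k1 k2 E; rewrite /poly_of (sum_by_key (fun K => 'X_[mon K]) keys_uniq k1).
rewrite (sum_by_key (fun K => 'X_[mon K]) keys_uniq k2) !big_seq; apply: eq_bigr => K KK.
by move/eq_in_map: E => /(_ K KK) ->.
Qed.

Lemma ev_val S : valid S -> ev S = poly_of k (keyed S) :> {mpoly k[21]}.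
Proof.
move/allP=> vS; rewrite /formal_eval /poly_of big_map linear_sum big_seq [RHS]big_seq.
apply: eq_bigr => p pS.
transitivity ((haf_monomial k (perm_word p.2) : {mpoly k[21]}) *~ p.1); first exact: raddfMz.
by rewrite haf_mon word_perm_word ?vS.
Qed.

Lemma keyed_in S : valid S -> all (fun p => p.2 \in keys) (keyed S).
Proof. by move/allP=> vS; rewrite /keyed all_map; apply/allP=> p /vS/key_in. Qed.

Lemma ev_eq S T : valid S -> valid T -> coords S = coords T -> ev S = ev T.
Proof.
move=> vS vT E; apply/val_inj; rewrite /= !ev_val //.
by apply: poly_of_eq => //; apply: keyed_in.
Qed.

Lemma ev_cat S T : ev (S ++ T) = ev S + ev T.
Proof. by rewrite /formal_eval big_cat. Qed.

Lemma ev_fscale c S : ev (fscale c S) = c%:~R *: ev S.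
Proof.
rewrite /formal_eval big_map scaler_sumr; apply: eq_bigr => p _.
by rewrite scaler_int mulrzA_C.
Qed.

Lemma ev_one s : ev [:: (1, word s)] = haf_monomial k s.
Proof. by rewrite /formal_eval big_seq1 perm_wordK. Qed.

Lemma ev_fmul S T : valid S -> valid T ->
  ev (fmul S T) = \sum_(q <- T) sact (perm_word q.2) (ev S) *~ q.1.
Proof.
move=> /allP vS /allP vT; rewrite /formal_eval big_allpairs_dep /= exchange_big /=.
rewrite big_seq [RHS]big_seq; apply: eq_bigr => q qT.
rewrite linear_sum mulrz_suml big_seq [RHS]big_seq; apply: eq_bigr => p pS.
rewrite raddfMz /= -haf_monomialM -mulrzA; congr (haf_monomial _ _ *~ _).
have [p_in q_in] := (vS _ pS, vT _ qT).
by apply: word_inj; rewrite wordM !word_perm_word ?mulw_in.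
Qed.

Lemma ev_in S : ev S \in MonHaf k.
Proof.
rewrite memv_suml // => p _; rewrite -scaler_int memvZ // MonHafE.
by rewrite haf_monomialE mem_orbit_span.
Qed.

(** An equivariant map is determined on MonHaf by its value at M0: it acts as left
    multiplication by any group algebra element representing this value. *)
Lemma ev_op (f : 'Hom(forms k 3, forms k 3)) S T :
    (forall s h, sact s (f h) = f (sact s h)) ->
    f (haf_monomial k 1) = ev S -> valid S -> valid T ->
  f (ev T) = ev (fmul S T).
Proof.
move=> eqf fS vS vT; rewrite ev_fmul // -fS {1}/formal_eval linear_sum; apply: eq_bigr => q _.
by rewrite raddfMz eqf -haf_monomialE.
Qed.

Lemma diff_act_haf b :
  diff_act (haf_monomial k 1) (signed_perm k b) = poly_of k (expansion b).
Proof.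
rewrite haf_mon diff_actX word1 -/base_word /signed_perm.
pose c w : int :=
  (if b && oddw w then -1 else 1) * (derive_factors (key base_word) (factors w)).1%:Z.
pose F w : {mpoly k[21]} :=
  'X_[mon (sort leq (derive_factors (key base_word) (factors w)).2)] *~ c w.
transitivity (\sum_(s : 'S_6) F (word s)).
  rewrite linear_sum; apply: eq_bigr => s _.
  rewrite -[LHS]/(mderivm (mon (key base_word)) _) prod_x_mon odd_permE mulr_sign /F /c.
  have K21 : all (gtn 21) (key base_word) by vm_compute.
  have f21 : all (gtn 21) (factors (word s)).
    by apply: (all_word (P := fun w => all (gtn 21) (factors w))); vm_compute.
  case: ifP => _; rewrite ?mulN1r ?mul1r ?mulrNz ?mderivmN mderivm_mon //;
    by rewrite (perm_mon (permEl (perm_sort _ _))).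
rewrite [LHS](sum_word xpredT F) /poly_of /expansion big_filter big_map [RHS]big_mkcond /=.
apply: eq_bigr => w _; rewrite /F -/(c w); case: eqP => [->|//]; by rewrite mulr0z.
Qed.

Lemma valid_contract b : valid (contract_f b).
Proof. by case: b; vm_compute. Qed.

(** The 720 terms are differentiated and collected by matching. *)
Lemma contract_haf b :
  diff_act (haf_monomial k 1) (signed_perm k b) = ev (contract_f b).
Proof.
rewrite diff_act_haf ev_val ?valid_contract //; apply: poly_of_eq.
- exact: expansion_keys.
- exact: keyed_in (valid_contract b).
- exact: expansion_vec.
Qed.

Lemma Phi_haf : Phi k (haf_monomial k 1) = ev Phi_f.
Proof. by apply/val_inj; rewrite /= apolarE /= permanentE (contract_haf false). Qed.

Lemma Psi_haf : Psi k (haf_monomial k 1) = ev Psi_f.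
Proof. by apply/val_inj; rewrite /= apolarE /= determinantE (contract_haf true). Qed.

Definition key_coef (K : seq nat) (h : forms k 3) : k := (h : {mpoly k[21]})@_(mon K).

Lemma key_coef_is_linear K : scalar (key_coef K).
Proof. by move=> c p q; rewrite /key_coef /= linearP. Qed.
HB.instance Definition _ K :=
  GRing.isLinear.Build k (forms k 3) k _ (key_coef K) (key_coef_is_linear K).

Lemma key_coef_ev K S : valid S -> K \in keys -> key_coef K (ev S) = (weight K (keyed S))%:~R.
Proof.
move=> vS KK; rewrite /key_coef ev_val // /poly_of.
rewrite (sum_by_key (fun K => 'X_[mon K]) keys_uniq (keyed_in vS)).
rewrite linear_sum (bigD1_seq K) ?keys_uniq //= raddfMz /= mcoeffX eqxx.
rewrite big1_seq ?addr0 // => L /andP[ne LK].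
rewrite raddfMz /= mcoeffX; case: eqP => [E|]; last by rewrite mul0rz.
have /allP wf := keys_wf; case/andP: (wf _ KK) => ? ?; case/andP: (wf _ LK) => ? ?.
by move: ne; rewrite (mon_inj _ _ _ _ E) ?eqxx.
Qed.

Definition pairing (Q S : formal) : int :=
  sumz [seq weight K (keyed Q) * weight K (keyed S) | K <- keys].

Definition dual (Q : formal) (h : forms k 3) : k :=
  \sum_(K <- keys) (weight K (keyed Q))%:~R * key_coef K h.

Lemma dual_is_linear Q : scalar (dual Q).
Proof.
move=> c p q; rewrite /dual mulr_sumr -big_split; apply: eq_bigr => K _ /=.
by rewrite linearP mulrDr mulrCA.
Qed.
HB.instance Definition _ Q :=
  GRing.isLinear.Build k (forms k 3) k _ (dual Q) (dual_is_linear Q).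

Lemma dual_ev Q T : valid T -> dual Q (ev T) = (pairing Q T)%:~R.
Proof.
move=> vT; rewrite /pairing sumzE big_map rmorph_sum /dual big_seq [RHS]big_seq.
by apply: eq_bigr => K KK; rewrite key_coef_ev // rmorphM.
Qed.

(** The pairing for which the matchings are orthonormal puts Qs and Ts in duality, up to
    the common factor d. *)
Definition dual_system (d : int) (Qs Ts : seq formal) : bool :=
  [seq [seq pairing Q T | T <- Ts] | Q <- Qs] ==
  [seq [seq if i == j then d else 0 | j <- iota 0 (size Ts)] | i <- iota 0 (size Ts)].

Lemma free_dual Qs Ts (d : int) :
  d%:~R != 0 :> k -> all valid Ts -> dual_system d Qs Ts -> free [seq ev T | T <- Ts].
Proof.
move=> nzd /allP vT /eqP E; set Z := map ev _.
have sZ : size Z = size Ts by rewrite size_map.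
have sQs : size Qs = size Ts by move/(congr1 size): E; rewrite !size_map size_iota.
rewrite -[Z]/(tval (in_tuple Z)); apply/freeP => c c0 i.
have iT : (i < size Ts)%N by rewrite -sZ.
have dualE j : (j < size Ts)%N ->
    dual (nth [::] Qs i) (nth 0 Z j) = if i == j :> nat then d%:~R else 0.
  move=> jT; rewrite (nth_map [::]) // dual_ev; last by apply: vT; apply: mem_nth.
  move: E => /(congr1 (fun M => nth 0 (nth [::] M i) j)).
  rewrite (nth_map [::]) ?sQs // (nth_map [::]) // => ->.
  rewrite (nth_map 0%N) ?size_iota // (nth_map 0%N) ?size_iota // !nth_iota // !add0n.
  by case: eqP.
have := congr1 (dual (nth [::] Qs i)) c0; rewrite linear_sum linear0 (bigD1 i) //= big1 => [|j ne].
  by rewrite addr0 linearZ /= dualE // eqxx => /eqP; rewrite mulf_eq0 (negPf nzd) orbF => /eqP.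
rewrite linearZ /= dualE -?sZ // ifN ?mulr0 //.
by rewrite eq_sym.
Qed.

End Eval.

(** * Minors, four-cycles and their identities *)

(** The six matchings between {0, 2, 4} and {1, 3, 5}. *)
Definition minor_words : seq (seq nat) :=
  [seq [:: 0; nth 0 w 0; 2; nth 0 w 1; 4; nth 0 w 2] | w <- permutations [:: 1; 3; 5]]%N.
Definition perm_minor : formal := fconst 1 minor_words.
Definition det_minor : formal := [seq (signw w, w) | w <- minor_words].

(** The triples {w 0, w 2, w 4} represent the ten splittings of the indices into two
    triples. *)
Definition split_words : seq (seq nat) :=
  [:: [:: 0; 1; 2; 3; 4; 5]; [:: 0; 1; 2; 3; 5; 4]; [:: 0; 1; 2; 4; 3; 5];
      [:: 0; 1; 3; 2; 4; 5]; [:: 0; 1; 3; 2; 5; 4]; [:: 0; 1; 4; 2; 5; 3];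
      [:: 0; 2; 1; 3; 4; 5]; [:: 0; 2; 1; 3; 5; 4]; [:: 0; 2; 1; 4; 3; 5];
      [:: 0; 3; 1; 4; 2; 5]]%N.
Definition translate (S : formal) (w : seq nat) : formal := fmul S [:: (1, w)].
Definition perm_minors : seq formal := map (translate perm_minor) split_words.
(** Two of the ten permanents have 6 common matchings if they are equal and 2 otherwise,
    so that pairing with one of them has values 4 + 2 and 2.  The constant part is removed
    with 2 one_common + none_common, the sum of the four permanents that contain M0 minus
    4 M0, whose pairing with each permanent is 8. *)
Definition perm_duals : seq formal :=
  [seq fscale 4 T ++ fconst (-2) one_common ++ fconst (-1) none_common | T <- perm_minors].

(** Five translates of the determinant that form a basis, over the integers, of the span
    of all of them. *)
Definition standard_words : seq (seq nat) :=
  [:: [:: 0; 1; 2; 3; 4; 5]; [:: 0; 1; 2; 3; 5; 4]; [:: 0; 1; 2; 4; 3; 5];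
      [:: 0; 1; 3; 2; 4; 5]; [:: 0; 1; 3; 2; 5; 4]]%N.
Definition det_minors : seq formal := map (translate det_minor) standard_words.
Definition det_duals : seq formal :=
  [:: fconst 1 [:: [:: 0; 3; 1; 4; 2; 5]%N];
      fconst 1 [:: [:: 0; 3; 1; 5; 2; 4]%N];
      fconst 1 [:: [:: 0; 3; 1; 5; 2; 4]%N] ++ fconst (-1) [:: [:: 0; 4; 1; 2; 3; 5]%N];
      fconst 1 [:: [:: 0; 2; 1; 4; 3; 5]%N];
      fconst 1 [:: [:: 0; 2; 1; 5; 3; 4]%N]].

Definition star (i j : nat) (c : int) : formal :=
  fconst c [seq w <- matchings | var_index i j \in key w].
(** The sum of the matchings through an edge is alternated around the cycle 4, 5, 0, 1.
    The edges are the tabloids of shape [4,2], and this is the image of a polytabloid. *)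
Definition four_cycle : formal := star 4 5 1 ++ star 0 5 (-1) ++ star 1 4 (-1) ++ star 0 1 1.
Definition stabilizer : formal := fconst 1 [seq w <- words | key w == key base_word].

Definition young_f lam : formal :=
  fmul (fconst 1 (row_words lam)) [seq (signw t, t) | t <- col_words lam].

Definition is_word (w : seq nat) := perm_eq w (iota 0 6).
Lemma is_wordE w : is_word w = (w \in words).
Proof. by rewrite wordsE mem_permutations. Qed.
Lemma validE T : valid T = all (fun p => is_word p.2) T.
Proof. by apply: eq_all => p; rewrite is_wordE. Qed.

Definition same_coords (S T : formal) := coords S == coords T.

Lemma Phi_perm_minor :
  same_coords (fmul Phi_f perm_minor) (fscale 8 perm_minor ++ fscale 16 hafnian_f).
Proof. by vm_compute. Qed.
Lemma Phi_Phi : same_coords (fmul Phi_f Phi_f) (fscale 8 Phi_f ++ fscale 128 hafnian_f).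
Proof. by vm_compute. Qed.
Lemma Phi_det_minor : same_coords (fmul Phi_f det_minor) [::].
Proof. by vm_compute. Qed.
Lemma Psi_det_minor : same_coords (fmul Psi_f det_minor) (fscale (-24) det_minor).
Proof. by vm_compute. Qed.
Lemma Phi_Psi : same_coords (fmul Phi_f Psi_f) [::].
Proof. by vm_compute. Qed.
Lemma Psi_Phi : same_coords (fmul Psi_f Phi_f) [::].
Proof. by vm_compute. Qed.
Lemma Phi_hafnian : same_coords (fmul Phi_f hafnian_f) (fscale 48 hafnian_f).
Proof. by vm_compute. Qed.
Lemma Phi_four_cycle : same_coords (fmul Phi_f four_cycle) (fscale 8 four_cycle).
Proof. by vm_compute. Qed.
(** In characteristic 0, the vectors of the eigenspace of Phi for 8 that are fixed by the
    stabilizer of M0 are the multiples of the projection of M0, a combination of Phi M0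
    and of the hafnian; the average of the four-cycle is one of them. *)
Lemma four_cycle_average :
  same_coords (fmul four_cycle stabilizer) (fscale 20 Phi_f ++ fscale (-64) hafnian_f).
Proof. by vm_compute. Qed.
Lemma young_6 : same_coords (young_f [:: 6]%N) (fscale 48 hafnian_f).
Proof. by vm_compute. Qed.
Lemma all_words_hafnian : same_coords (fconst 1 words) (fscale 48 hafnian_f).
Proof. by vm_compute. Qed.
Lemma young_42 : same_coords (young_f [:: 4; 2]%N) (fscale 16 four_cycle).
Proof. by vm_compute. Qed.
Lemma young_222 : same_coords (young_f [:: 2; 2; 2]%N) (fscale 48 det_minor).
Proof. by vm_compute. Qed.
Lemma perm_dual_system : dual_system 16 perm_duals perm_minors.
Proof. by vm_compute. Qed.
Lemma det_dual_system : dual_system 1 det_duals det_minors.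
Proof. by vm_compute. Qed.
Lemma matching_dual_system :
  dual_system 1 [seq [:: (1, w)] | w <- matchings] [seq [:: (1, w)] | w <- matchings].
Proof. by vm_compute. Qed.
Lemma valid_Phi : valid Phi_f. Proof. by rewrite validE; vm_compute. Qed.
Lemma valid_Psi : valid Psi_f. Proof. by rewrite validE; vm_compute. Qed.
Lemma valid_hafnian : valid hafnian_f. Proof. by rewrite validE; vm_compute. Qed.
Lemma valid_perm_minor : valid perm_minor. Proof. by rewrite validE; vm_compute. Qed.
Lemma valid_det_minor : valid det_minor. Proof. by rewrite validE; vm_compute. Qed.
Lemma valid_four_cycle : valid four_cycle. Proof. by rewrite validE; vm_compute. Qed.
Lemma valid_stabilizer : valid stabilizer.
Proof. by apply: valid_fconst => w; rewrite mem_filter => /andP[]. Qed.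
Lemma valid_young lam : valid (young_f lam).
Proof.
apply: valid_fmul; first by apply: valid_fconst => w; rewrite mem_filter => /andP[].
by rewrite /valid all_map; apply/allP=> w; rewrite mem_filter => /andP[].
Qed.

(** * Image and kernel of Phi *)

Section Main.
Variable k : fieldType.

Local Notation ev := (formal_eval k).

Lemma ev_same S T : same_coords S T -> valid S -> valid T -> ev S = ev T.
Proof. by move=> /eqP E vS vT; apply: ev_eq. Qed.

Lemma lfun_sub_scale (f : 'Hom(forms k 3, forms k 3)) u (c : k) v :
  f (u - c *: v) = f u - c *: f v.
Proof. by rewrite linearB linearZZ. Qed.

Lemma lfun_add (f : 'Hom(forms k 3, forms k 3)) u v : f (u + v) = f u + f v.
Proof. by rewrite linearD. Qed.

Lemma Phi_ev T : valid T -> Phi k (ev T) = ev (fmul Phi_f T).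
Proof. by apply: ev_op (@sact_Phi k) (Phi_haf k) _. Qed.

Lemma Psi_ev T : valid T -> Psi k (ev T) = ev (fmul Psi_f T).
Proof. by apply: ev_op (@sact_Psi k) (Psi_haf k) _. Qed.

Lemma ev0 : ev [::] = 0. Proof. by rewrite /formal_eval big_nil. Qed.

Lemma Phi_eigen T S : valid T -> valid S -> same_coords (fmul Phi_f T) S -> Phi k (ev T) = ev S.
Proof. by move=> vT vS h; rewrite Phi_ev //; apply: ev_same => //; apply: valid_fmul. Qed.

Lemma Psi_eigen T S : valid T -> valid S -> same_coords (fmul Psi_f T) S -> Psi k (ev T) = ev S.
Proof. by move=> vT vS h; rewrite Psi_ev //; apply: ev_same => //; apply: valid_fmul. Qed.

Lemma ev_translate S w : valid S -> w \in words ->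
  ev (translate S w) = sact (perm_word w) (ev S).
Proof. by move=> vS w_in; rewrite ev_fmul // /valid /= ?w_in // big_seq1. Qed.

Lemma limg_orbit_span (f : 'Hom(forms k 3, forms k 3)) x :
  (forall s h, sact s (f h) = f (sact s h)) ->
  (f @: orbit_span x)%VS = orbit_span (f x).
Proof.
move=> eqf; rewrite limg_span -map_comp; congr (<<_>>%VS).
by apply: eq_map => s; rewrite /= -eqf.
Qed.

Lemma image_Phi : (Phi k @: MonHaf k)%VS = orbit_span (ev Phi_f).
Proof. by rewrite MonHafE limg_orbit_span ?Phi_haf //; exact: sact_Phi. Qed.

Lemma image_Psi : (Psi k @: MonHaf k)%VS = orbit_span (ev Psi_f).
Proof. by rewrite MonHafE limg_orbit_span ?Psi_haf //; exact: sact_Psi. Qed.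

Lemma orbit_span_in_MonHaf T : (orbit_span (ev T) <= MonHaf k)%VS.
Proof. by rewrite MonHafE orbit_spanS // -MonHafE ev_in. Qed.

Lemma free_dim (s : seq (forms k 3)) (U : {vspace forms k 3}) :
  free s -> {subset s <= U} -> (size s <= \dim U)%N.
Proof. by move=> /eqP <- h; apply/dimvS/span_subvP. Qed.

Lemma dim_MonHaf : \dim (MonHaf k) = 15%N.
Proof.
apply/eqP; rewrite eqn_leq; apply/andP; split.
  have sub : (MonHaf k <= <<[seq haf_monomial k (perm_word w) | w <- matchings]>>)%VS.
    apply/span_subvP=> _ /imageP[s _ ->]; apply: memv_span.
    have /mapP[w wM E] := key_in (word_in s); apply/mapP; exists w => //.
    apply/val_inj/(etrans (haf_mon k s)).
    by rewrite E -{1}(word_perm_word (matchings_in wM)) -haf_mon.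
  by apply: leq_trans (dimvS sub) (dim_span _).
have := free_dual (oner_neq0 k : 1%:~R != 0) _ matching_dual_system => /(_ isT) fr.
by apply: leq_trans (free_dim fr _) => // _ /mapP[T _ ->]; apply: ev_in.
Qed.

Lemma xiE d (F : forms k d) : xi k d F = F.
Proof.
rewrite lfunE; apply/val_inj; rewrite /= -[RHS]comp_mpoly_id; congr (_ \mPo _).
by apply: eq_from_tnth => v; rewrite !tnth_mktuple /y_ varK.
Qed.

Lemma xi_img d (U : {vspace forms k d}) : (xi k d @: U)%VS = U.
Proof.
have -> : xi k d = \1%VF by apply/lfunP=> x; rewrite xiE id_lfunE.
exact: lim1g.
Qed.

(** The integers inverted below have no prime factor other than 2, 3 and 5. *)
Lemma natr_neq0 n : (0 < n)%N -> (forall p, p \in primes n -> p \notin [pchar k]) ->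
  n%:R != 0 :> k.
Proof.
move=> n0 h; rewrite natf_neq0_pchar; apply/pnatP=> // p pr dv.
by rewrite inE /= h // mem_primes pr n0 dv.
Qed.

Hypothesis k_char : forall p : nat, p \in [pchar k] -> (2 < p)%N.

Lemma two_notin_pchar : 2%N \notin [pchar k].
Proof. by apply/negP=> /k_char. Qed.

Lemma pow2_neq0 n : (0 < n)%N -> primes n = [:: 2%N] -> n%:R != 0 :> k.
Proof.
move=> n0 pn; apply: natr_neq0 => // p.
by rewrite pn inE => /eqP->; apply: two_notin_pchar.
Qed.

Local Notation I := (Phi k @: MonHaf k)%VS.
Local Notation K := (lker (Phi k) :&: MonHaf k)%VS.

Lemma scale_cancel n (v : forms k 3) (U : {vspace forms k 3}) :
  n%:R != 0 :> k -> n%:R *: v \in U -> v \in U.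
Proof. by move=> nz /(memvZ n%:R^-1); rewrite scalerA mulVf // scale1r. Qed.

Lemma valid_comb a S b T : valid S -> valid T -> valid (fscale a S ++ fscale b T).
Proof. by rewrite valid_cat !valid_fscale => -> ->. Qed.

Lemma ev_comb (a b : nat) S T :
  ev (fscale a%:R S ++ fscale b%:R T) = a%:R *: ev S + b%:R *: ev T.
Proof. by rewrite ev_cat !ev_fscale !rmorph_nat. Qed.

Lemma image_stable s h : h \in I -> sact s h \in I.
Proof. by rewrite image_Phi; apply: orbit_span_stable. Qed.

Lemma kernel_stable s h : h \in K -> sact s h \in K.
Proof.
rewrite !memv_cap !memv_ker -sact_Phi => /andP[/eqP-> hV].
by rewrite linear0 eqxx MonHafE orbit_span_stable -?MonHafE.
Qed.

(** Applying Phi to the hafnian gives 48 times it, which is useless in characteristic 3;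
    Phi (Phi M0 - 8 M0) = 128 hafnian only needs 2 to be invertible. *)
Lemma hafnian_in_image : ev hafnian_f \in I.
Proof.
apply: (@scale_cancel 128); first exact: pow2_neq0.
have E : Phi k (ev Phi_f) = 8%:R *: ev Phi_f + 128%:R *: ev hafnian_f.
  by rewrite (Phi_eigen valid_Phi (valid_comb _ _ valid_Phi valid_hafnian) Phi_Phi) ev_comb.
have -> : 128%:R *: ev hafnian_f = Phi k (ev Phi_f - 8%:R *: ev (base_f)).
  have E1 : Phi k (ev base_f) = ev Phi_f by rewrite -Phi_haf -ev_one word1.
  by rewrite lfun_sub_scale E E1 addrAC subrr add0r.
by apply: memv_img; apply: rpredB; rewrite ?rpredZ ?ev_in.
Qed.

Lemma perm_minor_in_image : ev perm_minor \in I.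
Proof.
apply: (@scale_cancel 8); first exact: pow2_neq0.
have E : Phi k (ev perm_minor) = 8%:R *: ev perm_minor + 16%:R *: ev hafnian_f.
  rewrite (Phi_eigen valid_perm_minor (valid_comb _ _ valid_perm_minor valid_hafnian)
             Phi_perm_minor).
  by rewrite ev_comb.
have -> : 8%:R *: ev perm_minor = Phi k (ev perm_minor) - 16%:R *: ev hafnian_f by rewrite E addrK.
by apply: rpredB; [rewrite memv_img ?ev_in|rewrite rpredZ ?hafnian_in_image].
Qed.

Lemma Phi_det_minor0 : Phi k (ev det_minor) = 0.
Proof. by rewrite (Phi_eigen valid_det_minor (isT : valid [::]) Phi_det_minor) ev0. Qed.

Lemma det_minor_in_kernel : ev det_minor \in K.
Proof. by rewrite memv_cap memv_ker Phi_det_minor0 eqxx ev_in. Qed.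

Lemma free_perm_minors : free [seq ev T | T <- perm_minors].
Proof.
apply: (free_dual _ _ perm_dual_system); last by vm_compute.
exact: (@pow2_neq0 16).
Qed.

Lemma free_det_minors : free [seq ev T | T <- det_minors].
Proof.
by apply: (free_dual _ _ det_dual_system); [exact: oner_neq0|vm_compute].
Qed.

Lemma split_words_in w : w \in split_words -> w \in words.
Proof. by rewrite -is_wordE; move: w; apply/allP. Qed.

Lemma standard_words_in w : w \in standard_words -> w \in words.
Proof. by rewrite -is_wordE; move: w; apply/allP. Qed.

Lemma dim_image_ge : (10 <= \dim I)%N.
Proof.
apply: leq_trans (free_dim free_perm_minors _) => // _ /mapP[_ /mapP[w wS ->] ->].
rewrite (ev_translate valid_perm_minor) ?split_words_in //.
exact/image_stable/perm_minor_in_image.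
Qed.

Lemma dim_det_minor_span_ge : (5 <= \dim (orbit_span (ev det_minor)))%N.
Proof.
apply: leq_trans (free_dim free_det_minors _) => // _ /mapP[_ /mapP[w wS ->] ->].
by rewrite (ev_translate valid_det_minor) ?standard_words_in ?mem_orbit_span.
Qed.

Lemma det_minor_span_sub : (orbit_span (ev det_minor) <= K)%VS.
Proof. by apply: sub_orbit_span => s; apply/kernel_stable/det_minor_in_kernel. Qed.

(** Rank-nullity leaves no room between the two lower bounds. *)
Lemma dim_kernel_image : \dim K = 5%N /\ \dim I = 10%N.
Proof.
have := limg_ker_dim (Phi k) (MonHaf k); rewrite capvC dim_MonHaf => E.
have := leq_trans dim_det_minor_span_ge (dimvS det_minor_span_sub).
have := dim_image_ge; rewrite -(leq_add2l (\dim K)) E => h1 h2.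
have K5 : \dim K = 5%N by apply/eqP; rewrite eqn_leq h2 -(leq_add2r 10) h1.
by split=> //; apply/eqP; rewrite -(eqn_add2l (\dim K)) E K5.
Qed.

Lemma kernelE : K = orbit_span (ev det_minor).
Proof.
apply/esym/eqP; rewrite eqEdim det_minor_span_sub (dim_kernel_image).1.
exact: dim_det_minor_span_ge.
Qed.

Lemma natr23_neq0 n : 3%N \notin [pchar k] -> (0 < n)%N ->
  all (mem [:: 2; 3]%N) (primes n) -> n%:R != 0 :> k.
Proof.
move=> c3 n0 /allP pn; apply: natr_neq0 => // p /pn.
by rewrite !inE => /pred2P[]->; rewrite ?two_notin_pchar.
Qed.

Lemma natr235_neq0 n : 3%N \notin [pchar k] -> 5%N \notin [pchar k] -> (0 < n)%N ->
  all (mem [:: 2; 3; 5]%N) (primes n) -> n%:R != 0 :> k.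
Proof.
move=> c3 c5 n0 /allP pn; apply: natr_neq0 => // p /pn.
by rewrite !inE => /or3P[] /eqP->; rewrite ?two_notin_pchar.
Qed.

(** * The duality between Phi and Psi *)

(** One inclusion is Phi Psi = 0; the other holds as Psi multiplies the generator of the
    kernel by -24. *)
Lemma image_Psi_kernel : 3%N \notin [pchar k] -> (Psi k @: MonHaf k)%VS = K.
Proof.
move=> c3; apply/eqP; rewrite eqEsubv image_Psi; apply/andP; split.
  apply: sub_orbit_span => s; apply: kernel_stable.
  by rewrite memv_cap memv_ker ev_in (Phi_eigen valid_Psi (isT : valid [::]) Phi_Psi) ev0 eqxx.
rewrite kernelE; apply: orbit_spanS; apply: (@scale_cancel 24); first exact: natr23_neq0.
have -> : 24%:R *: ev det_minor = - Psi k (ev det_minor).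
  have vS c : valid (fscale c det_minor) by rewrite valid_fscale valid_det_minor.
  rewrite (Psi_eigen valid_det_minor (vS _) Psi_det_minor) ev_fscale.
  by rewrite rmorphN rmorph_nat scaleNr opprK.
by rewrite rpredN -image_Psi memv_img ?ev_in.
Qed.

(** The inclusion Psi Phi = 0 is an equality of dimensions 10 = 15 - 5. *)
Lemma kernel_Psi_image : 3%N \notin [pchar k] -> (lker (Psi k) :&: MonHaf k)%VS = I.
Proof.
move=> c3; apply/esym/eqP; rewrite eqEdim; apply/andP; split.
  rewrite image_Phi; apply: sub_orbit_span => s; rewrite memv_cap memv_ker -sact_Psi.
  rewrite (Psi_eigen valid_Phi (isT : valid [::]) Psi_Phi) ev0 linear0 eqxx /=.
  by rewrite MonHafE orbit_span_stable // -MonHafE ev_in.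
have := limg_ker_dim (Psi k) (MonHaf k); rewrite capvC image_Psi_kernel // dim_MonHaf.
by rewrite dim_kernel_image.1 dim_kernel_image.2 => /eqP; rewrite (eqn_add2r 5 _ 10) => /eqP->.
Qed.

(** * The Specht modules inside MonHaf *)

Lemma orbit_span_scale (c : k) (x : forms k 3) :
  c != 0 -> orbit_span (c *: x) = orbit_span x.
Proof.
move=> nz; apply/eqP; rewrite eqEsubv; apply/andP; split.
  by apply: orbit_spanS; rewrite memvZ ?orbit_span_id.
apply: orbit_spanS; rewrite -[x in x \in _](scalerK nz).
by rewrite memvZ ?orbit_span_id.
Qed.

Lemma young_ev lam : orbit_map (young_symmetrizer k lam) = ev (young_f lam).
Proof.
rewrite linear_sum /young_f /young_symmetrizer /formal_eval big_allpairs_dep big_map /= big_filter.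
rewrite -(sum_word (preserves (reshape_index lam))
  (fun v => \sum_(q <- [seq (signw t, t) | t <- col_words lam])
   haf_monomial k (perm_word (mulw v q.2)) *~ (1 * q.1))).
apply: eq_big => [s|s _]; first exact: in_row_stab.
rewrite linear_sum big_map big_filter /=.
rewrite -(sum_word (preserves (reshape_offset lam)) (fun v =>
   haf_monomial k (perm_word (mulw (word s) v)) *~ (1 * signw v))).
apply: eq_big => [t|t _]; first exact: in_col_stab.
rewrite linearZ /= orbit_map_delta -wordM perm_wordK mul1r.
by rewrite -scaler_int signwE.
Qed.

(** What remains for each shape is an integral identity and the invertibility of a few
    integers. *)
Lemma specht_affords lam T n : straightens lam -> (young_square_coef lam)%:~R != 0 :> k ->
    valid T -> same_coords (young_f lam) (fscale n%:Z T) -> n%:R != 0 :> k -> ev T != 0 ->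
  [/\ mx_irreducible (specht_repr k lam),
     affords (orbit_span (ev T)) (specht_repr k lam) &
     \rank (specht_mx k lam) = \dim (orbit_span (ev T))].
Proof.
move=> str kappa_neq0 vT eqT nz_n nzT.
have E : orbit_map (young_symmetrizer k lam) = n%:R *: ev T.
  by rewrite young_ev (ev_same eqT (valid_young lam)) ?valid_fscale // ev_fscale.
have nzE : orbit_map (young_symmetrizer k lam) != 0 by rewrite E scaler_eq0 negb_or nz_n.
have nzy : young_symmetrizer k lam != 0.
  by apply: contraNneq nzE => ->; rewrite linear0.
have two : 2%:R != 0 :> k by apply: pow2_neq0.
have simS := specht_mxsimple two str kappa_neq0 nzy.
have [aff dimE] := affords_specht simS nzE.
rewrite E orbit_span_scale // in aff dimE.
by split=> //; apply/(submod_mx_irr (cyclic_mx_module _ _)).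
Qed.

Lemma ev_neq0 T K : valid T -> K \in keys -> (weight K (keyed T))%:~R != 0 :> k -> ev T != 0.
Proof. by move=> vT KK; apply: contraNneq => T0; rewrite -key_coef_ev // T0 linear0. Qed.

Lemma specht_222 : 3%N \notin [pchar k] ->
  [/\ mx_irreducible (specht_repr k [:: 2; 2; 2]%N),
      affords K (specht_repr k [:: 2; 2; 2]%N) &
      \rank (specht_mx k [:: 2; 2; 2]%N) = 5%N].
Proof.
move=> c3; have kappa_neq0 : (young_square_coef [:: 2; 2; 2]%N)%:~R != 0 :> k.
  by rewrite young_square_222 rmorph_nat; apply: (@natr23_neq0 144).
have nzD : ev det_minor != 0 by apply: (ev_neq0 valid_det_minor (mem_head _ _)); apply: oner_neq0.
have nz48 : 48%:R != 0 :> k by apply: natr23_neq0.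
have [irr aff rk] :=
  specht_affords straightens_222 kappa_neq0 valid_det_minor young_222 nz48 nzD.
by split; rewrite ?rk ?kernelE // -kernelE dim_kernel_image.1.
Qed.

Lemma hafnian_neq0 : ev hafnian_f != 0.
Proof.
by apply: (ev_neq0 valid_hafnian (mem_head _ _)); apply: oner_neq0.
Qed.

Lemma eigen_orbit_span (f : 'Hom(forms k 3, forms k 3)) (c : k) x y :
    (forall s h, sact s (f h) = f (sact s h)) ->
  f x = c *: x -> y \in orbit_span x -> f y = c *: y.
Proof.
move=> eqf Ex; have sub : (orbit_span x <= lker (f - c *: \1%VF))%VS.
  apply: sub_orbit_span => s; rewrite memv_ker !lfun_simp -eqf Ex linearZZ.
  by rewrite subrr.
by move=> /(subvP sub); rewrite memv_ker !lfun_simp subr_eq0 => /eqP.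
Qed.

Section PrimeTo30.
Hypotheses (c3 : 3%N \notin [pchar k]) (c5 : 5%N \notin [pchar k]).

Local Notation W6 := (orbit_span (ev hafnian_f)).
Local Notation W42 := (orbit_span (ev four_cycle)).

Lemma specht_6 :
  [/\ mx_irreducible (specht_repr k [:: 6]%N),
      affords W6 (specht_repr k [:: 6]%N) &
      \rank (specht_mx k [:: 6]%N) = \dim W6].
Proof.
have kappa_neq0 : (young_square_coef [:: 6]%N)%:~R != 0 :> k.
  by rewrite young_square_6 rmorph_nat; apply: (@natr235_neq0 720).
have nz48 : 48%:R != 0 :> k by apply: natr23_neq0.
exact: specht_affords straightens_6 kappa_neq0 valid_hafnian young_6 nz48 hafnian_neq0.
Qed.

Lemma specht_42 :
  [/\ mx_irreducible (specht_repr k [:: 4; 2]%N),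
      affords W42 (specht_repr k [:: 4; 2]%N) &
      \rank (specht_mx k [:: 4; 2]%N) = \dim W42].
Proof.
have kappa_neq0 : (young_square_coef [:: 4; 2]%N)%:~R != 0 :> k.
  by rewrite young_square_42 rmorph_nat; apply: (@natr235_neq0 80).
have nz16 : 16%:R != 0 :> k by apply: pow2_neq0.
have nz4 : ev four_cycle != 0.
  apply: (ev_neq0 valid_four_cycle (mem_head _ _)).
  have -> : weight (key base_word) (keyed four_cycle) = 2%:R by vm_compute.
  by rewrite rmorph_nat; apply: pow2_neq0.
exact: specht_affords straightens_42 kappa_neq0 valid_four_cycle young_42 nz16 nz4.
Qed.

(** 48 times the hafnian is the sum of all 720 monomials, each matching having a
    stabilizer of order 48. *)
Lemma sact_hafnian s : sact s (ev hafnian_f) = ev hafnian_f.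
Proof.
have nz : 48%:R != 0 :> k by apply: natr23_neq0.
apply: (scalerI nz); rewrite -linearZZ.
have <- : \sum_t haf_monomial k t = 48%:R *: ev hafnian_f.
  have vS : valid (fscale 48 hafnian_f) by rewrite valid_fscale valid_hafnian.
  rewrite -[48%:R](rmorph_nat (intr : int -> k)) -ev_fscale -(ev_same all_words_hafnian _ vS).
    rewrite /formal_eval big_map.
    rewrite (eq_bigr (fun t => (fun w => haf_monomial k (perm_word w) *~ 1) (word t))).
      exact: (sum_word xpredT (fun w => haf_monomial k (perm_word w) *~ 1)).
    by move=> t _; rewrite perm_wordK.
  exact: valid_fconst.
rewrite linear_sum [RHS](reindex_inj (mulIg s)); apply: eq_bigr => t _.
by rewrite haf_monomialM.
Qed.

Lemma W6E : W6 = <[ev hafnian_f]>%VS.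
Proof.
apply/eqP; rewrite eqEsubv -memvE orbit_span_id andbT.
by apply: sub_orbit_span => s; rewrite sact_hafnian memv_line.
Qed.

Lemma Phi_scalar_W42 x : x \in W42 -> Phi k x = 8%:R *: x.
Proof.
apply: (eigen_orbit_span (@sact_Phi k)).
have vS : valid (fscale 8 four_cycle) by rewrite valid_fscale valid_four_cycle.
by rewrite (Phi_eigen valid_four_cycle vS Phi_four_cycle) ev_fscale rmorph_nat.
Qed.

Lemma Phi_scalar_W6 x : x \in W6 -> Phi k x = 48%:R *: x.
Proof.
apply: (eigen_orbit_span (@sact_Phi k)).
have vS : valid (fscale 48 hafnian_f) by rewrite valid_fscale valid_hafnian.
by rewrite (Phi_eigen valid_hafnian vS Phi_hafnian) ev_fscale rmorph_nat.
Qed.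

(** Phi acts on the two by 48 and 8, and 40 is invertible. *)
Lemma W6_W42_disjoint : (W6 :&: W42 = 0)%VS.
Proof.
apply/eqP; rewrite -subv0; apply/subvP=> x; rewrite memv_cap => /andP[x6 x42].
rewrite memv0; have /eqP := Phi_scalar_W6 x6; rewrite (Phi_scalar_W42 x42) -subr_eq0 -scalerBl.
rewrite scaler_eq0 => /orP[|//]; rewrite -opprB oppr_eq0 -natrB //.
by rewrite (negPf (natr235_neq0 _ _ _ _)).
Qed.

(** The generator Phi M0 of the image is recovered, up to 20, from the hafnian and the
    average of the four-cycle. *)
Lemma imageE : I = (W6 + W42)%VS.
Proof.
have stable s x : x \in (W6 + W42)%VS -> sact s x \in (W6 + W42)%VS.
  case/memv_addP=> y y6 [z z42 ->]; rewrite linearD memv_add //=.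
    exact: orbit_span_stable.
  exact: orbit_span_stable.
apply/eqP; rewrite eqEsubv subv_add; apply/and3P; split.
- rewrite image_Phi; apply: sub_orbit_span => s; apply: stable.
  apply: (@scale_cancel 20); first exact: natr235_neq0.
  have E : ev (fmul four_cycle stabilizer) = 20%:R *: ev Phi_f - 64%:R *: ev hafnian_f.
    rewrite (ev_same four_cycle_average (valid_fmul valid_four_cycle valid_stabilizer)
               (valid_comb _ _ valid_Phi valid_hafnian)).
    by rewrite ev_cat !ev_fscale rmorphN !rmorph_nat scaleNr.
  have -> : 20%:R *: ev Phi_f = 64%:R *: ev hafnian_f + ev (fmul four_cycle stabilizer).
    by rewrite E addrC subrK.
  rewrite memv_add ?memvZ ?orbit_span_id //.
  rewrite (ev_fmul _ valid_four_cycle valid_stabilizer) memv_suml // => q _.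
  by rewrite -scaler_int memvZ // mem_orbit_span.
- by rewrite W6E -memvE hafnian_in_image.
- apply: sub_orbit_span => s; apply: image_stable.
  apply: (@scale_cancel 8); first exact: pow2_neq0.
  by rewrite -(Phi_scalar_W42 (orbit_span_id _)) memv_img ?ev_in.
Qed.

Lemma dim_W6 : \dim W6 = 1%N.
Proof.
by rewrite W6E dim_vline hafnian_neq0.
Qed.

Lemma dim_W42 : \dim W42 = 9%N.
Proof.
have := dimv_disjoint_sum W6_W42_disjoint.
by rewrite -imageE dim_kernel_image.2 dim_W6 => -[].
Qed.

(** Phi is injective on the image, where it acts by 48 and 8; so the image and the kernel
    meet trivially and their dimensions add up to 15. *)
Lemma MonHaf_sum : MonHaf k = (W6 + W42 + K)%VS /\ (I :&: K = 0)%VS.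
Proof.
have dis : (I :&: K = 0)%VS.
  apply/eqP; rewrite -subv0; apply/subvP=> x; rewrite memv_cap imageE => /andP[].
  case/memv_addP=> y y6 [z z42 ->]; rewrite memv_cap memv_ker => /andP[/eqP E _].
  move: E; rewrite lfun_add (Phi_scalar_W6 y6) (Phi_scalar_W42 z42) => E.
  have y42 : y \in W42.
    apply: (@scale_cancel 48); first exact: natr23_neq0.
    by rewrite -[_ *: y]opprK (addr0_eq E) rpredN memvZ.
  have y0 : y = 0.
    by apply/eqP; rewrite -memv0 -W6_W42_disjoint memv_cap y6.
  by move/eqP: E; rewrite y0 scaler0 !add0r scaler_eq0 (negPf (pow2_neq0 _ _)) // memv0.
split=> //; apply/esym/eqP; rewrite eqEdim -imageE; apply/andP; split.
  rewrite subv_add capvSr andbT image_Phi; exact: orbit_span_in_MonHaf.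
by rewrite dim_MonHaf dimv_disjoint_sum // dim_kernel_image.1 dim_kernel_image.2.
Qed.

Lemma image_specht_sum : specht_sum I [:: [:: 6]; [:: 4; 2]]%N.
Proof.
have [_ aff6 _] := specht_6; have [_ aff42 _] := specht_42.
exists (fun i : 'I_2 => nth 0%VS [:: W6; W42] i); split.
- by rewrite !big_ord_recl big_ord0 /= addv0 imageE.
- rewrite directvE /= !big_ord_recl !big_ord0 /= addv0 addn0.
  by rewrite dimv_disjoint_sum ?W6_W42_disjoint.
by case=> [[|[|i]] Hi].
Qed.

Lemma MonHaf_specht_sum :
  specht_sum (MonHaf k) [:: [:: 6]; [:: 4; 2]; [:: 2; 2; 2]]%N.
Proof.
have [_ aff6 _] := specht_6; have [_ aff42 _] := specht_42.
have [_ aff222 _] := specht_222 c3; have [sumE dis] := MonHaf_sum.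
exists (fun i : 'I_3 => nth 0%VS [:: W6; W42; K] i); split.
- by rewrite !big_ord_recl big_ord0 /= addv0 addvA -sumE.
- rewrite directvE /= !big_ord_recl !big_ord0 /= addv0 addn0 addvA -sumE dim_MonHaf.
  by rewrite dim_W6 dim_W42 dim_kernel_image.1.
by case=> [[|[|[|i]]] Hi].
Qed.

End PrimeTo30.
End Main.

Theorem lemma5p6 (k : fieldType) (k_inf : infinite_field k)
    (k_char : forall p : nat, p \in [pchar k] -> (2 < p)%N) :
  [/\ \dim (MonHaf k) = 15%N,
      (Phi k @: MonHaf k <= P3 k)%VS /\ (Psi k @: MonHaf k <= M3 k)%VS,
      \dim (Phi k @: MonHaf k) = 10%N /\ \dim (lker (Phi k) :&: MonHaf k) = 5%N,
      (* If 15 = 0 in k, the invariant line of MonHaf has no invariant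
         complement, so MonHaf is not a direct sum of irreducibles. *)
      3%N \notin [pchar k] -> 5%N \notin [pchar k] ->
      [/\ mx_irreducible (specht_repr k [:: 6]%N) /\
            \rank (specht_mx k [:: 6]%N) = 1%N,
          mx_irreducible (specht_repr k [:: 4; 2]%N) /\
            \rank (specht_mx k [:: 4; 2]%N) = 9%N,
          mx_irreducible (specht_repr k [:: 2; 2; 2]%N) /\
            \rank (specht_mx k [:: 2; 2; 2]%N) = 5%N,
          specht_sum (MonHaf k) [:: [:: 6]; [:: 4; 2]; [:: 2; 2; 2]]%N &
          specht_sum (Phi k @: MonHaf k) [:: [:: 6]; [:: 4; 2]]%N] &
      (* In characteristic 3, the image of Psi is only a line, while the
         kernel of Phi still has dimension 5. *)
      3%N \notin [pchar k] ->
      [/\ mx_irreducible (specht_repr k [:: 2; 2; 2]%N) /\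
            affords (lker (Phi k) :&: MonHaf k) (specht_repr k [:: 2; 2; 2]%N),
          (lker (Phi k) :&: MonHaf k = xi k 3 @: (Psi k @: MonHaf k))%VS &
          (lker (Psi k) :&: MonHaf k = xi k 3 @: (Phi k @: MonHaf k))%VS]].
Proof.
have [dimK dimI] := dim_kernel_image k_char.
split=> [||//|c3 c5|c3]; first exact: dim_MonHaf.
- by split; apply/limgS/subvf.
- have [irr6 _ rk6] := specht_6 k_char c3 c5.
  have [irr42 _ rk42] := specht_42 k_char c3 c5.
  have [irr222 _ rk222] := specht_222 k_char c3.
  split=> //.
  + by split=> //; rewrite rk6 (dim_W6 k_char c3).
  + by split=> //; rewrite rk42 (dim_W42 k_char c3 c5).
  + exact: MonHaf_specht_sum.
  + exact: image_specht_sum.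
have [irr222 aff222 _] := specht_222 k_char c3.
split=> //; first by rewrite xi_img image_Psi_kernel.
by rewrite xi_img kernel_Psi_image.
Qed.
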